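(* In connective $K$-theory (setup below), for all $v,w\in W$: (1) $\psi^v(w)=\theta_w\,K^Y(v,w)$; (2) $\xi^v(w)=K^X(v,w)$.
   Context: Let $R=\mathbb Z[t]$ and $F(x,y)=x+y-txy$. Let $\Phi$ be a finite root system with weight lattice $\Lambda$, positive roots $\Phi^+$, negative roots $\Phi^-$, simple roots $\alpha_1,\dots,\alpha_n$, simple reflections $s_i$, Weyl group $W$ with length $\ell$, Bruhat order $\le$, longest element $w_\circ$. Let $S=R[[x_\lambda]]_{\lambda\in\Lambda}/(x_0,\;x_{\lambda+\nu}-F(x_\lambda,x_\nu))$ with $W$-action $w(x_\lambda)=x_{w\lambda}$, $Q$ its localization at all $x_\alpha$, $\alpha\in\Phi$, and $Q_W$ the twisted group algebra: free left $Q$-module on $\{\delta_w\}$ with $q\delta_w\cdot q'\delta_{w'}=q\,w(q')\,\delta_{ww'}$. Put $X_i=\frac1{x_{\alpha_i}}(\delta_{s_i}-1)$ and $Y_i=\frac1{x_{-\alpha_i}}+\frac1{x_{\alpha_i}}\delta_{s_i}$; they satisfy $Y_i^2=tY_i$, $X_i^2=-tX_i$ and the braid relations, so $X_v:=X_{i_1}\cdots X_{i_l}$ and $Y_v:=Y_{i_1}\cdots Y_{i_l}$ for a reduced word $(i_1,\dots,i_l)$ of $v$ are well defined, and $\{X_v\}$, $\{Y_v\}$ are left $Q$-bases of $Q_W$. Root polynomials: in $S\otimes_R Q_W$ (the left factor $S$, written in variables $y_\lambda$, commutes with $Q_W$), for $w\in W$ with reduced word $(i_1,\dots,i_l)$ and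 $\beta_k=s_{i_1}\cdots s_{i_{k-1}}\alpha_{i_k}$, set $\mathcal R^Y_w=\prod_{k=1}^l(1-y_{\beta_k}Y_{i_k})$ and $\mathcal R^X_w=\prod_{k=1}^l(1+y_{-\beta_k}X_{i_k})$ (ordered products; independent of the reduced word). Define $K^Y(v,w),K^X(v,w)\in S$ by $\mathcal R^Y_w=\sum_v K^Y(v,w)Y_v$ and $\mathcal R^X_w=\sum_vK^X(v,w)X_v$, and identify the left factor with $S$ via $y_\lambda\leftrightarrow x_\lambda$. Let $\theta_w=\prod_{\beta\in\Phi^+\cap w\Phi^-}\frac{1}{1-tx_\beta}\ (=\prod_{\beta}(-x_{-\beta}/x_\beta))$. GKM model: functions $f:W\to Q$ with $(X_if)(w)=\frac{f(ws_i)-f(w)}{x_{w\alpha_i}}$ and $(Y_if)(w)=\frac{f(w)}{x_{-w\alpha_i}}+\frac{f(ws_i)}{x_{w\alpha_i}}$. Let $\zeta_\emptyset(w)=\prod_{\alpha\in\Phi^+}x_{-\alpha}$ if $w=\mathrm{id}$, $0$ otherwise; for $u\in W$ with reduced word $(i_1,\dots,i_l)$ let $\widetilde\zeta_u=X_{i_l}\cdots X_{i_1}\zeta_\emptyset$ and $\zeta_u=Y_{i_l}\cdots Y_{i_1}\zeta_\emptyset$. Define $\psi^v(w):=\widetilde\zeta_{vw_\circ}(ww_\circ)$ and $\xi^v(w):=\zeta_{vw_\circ}(ww_\circ)$. *)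

(* Defs.v *)
From HB Require Import structures.
From mathcomp Require Import all_boot all_order all_algebra.
From Stdlib Require Import ClassicalEpsilon.
Set Implicit Arguments. Unset Strict Implicit. Unset Printing Implicit Defensive.
Import Order.TTheory GRing.Theory Num.Theory.
Local Open Scope ring_scope.

Definition pb (P : Prop) : bool :=
  if excluded_middle_informative P then true else false.

Section RootSystem.
Variable n : nat.
(* Weights are integer column vectors in the basis of fundamental weights,
   so Lambda = Z^n is the full weight lattice; Weyl group elements are
   integer matrices acting on Lambda by left multiplication. *)
Local Notation Mat := 'M[int]_n.
Local Notation Lam := 'cV[int]_n.

(* Generalized Cartan matrix, Kac convention C i j = <alpha_i^vee, alpha_j>. *)
Definition cartan (C : Mat) : Prop :=
  [/\ forall i, C i i = 2,
      forall i j, i != j -> C i j <= 0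
    & forall i j, (C i j == 0) = (C j i == 0)].

(* alpha_i written in fundamental weight coordinates *)
Definition simple_root (C : Mat) (i : 'I_n) : Lam := col i C.

(* s_i(lambda) = lambda - <lambda, alpha_i^vee> alpha_i *)
Definition sref (C : Mat) (i : 'I_n) : Mat :=
  \matrix_(j, k) ((j == k)%:R - C j i * (k == i)%:R).

Definition wordmx (C : Mat) (s : seq 'I_n) : Mat :=
  foldr (fun i M => sref C i *m M) 1%:M s.

Definition inW (C : Mat) (w : Mat) : Prop := exists s, w = wordmx C s.

Definition reduced (C : Mat) (s : seq 'I_n) : Prop :=
  forall s', wordmx C s' = wordmx C s -> (size s <= size s')%N.

Definition rword (C : Mat) (w : Mat) : seq 'I_n :=
  epsilon (inhabits [::]) (fun s => reduced C s /\ wordmx C s = w).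

Definition wlength (C : Mat) (w : Mat) : nat := size (rword C w).

Definition longest (C : Mat) (w0 : Mat) : Prop :=
  inW C w0 /\ forall w, inW C w -> (wlength C w <= wlength C w0)%N.

Definition is_root (C : Mat) (b : Lam) : Prop :=
  exists w i, inW C w /\ b = w *m simple_root C i.

(* positive root: nonnegative integer coefficients in the simple roots *)
Definition pos_root (C : Mat) (b : Lam) : Prop :=
  is_root C b /\ exists c : Lam, (forall i, 0 <= c i 0) /\ b = C *m c.

Definition neg_root (C : Mat) (b : Lam) : Prop := pos_root C (- b).

(* Wl is an enumeration of W (see the theorem) *)
Definition roots (C : Mat) (Wl : seq Mat) : seq Lam :=
  undup [seq w *m simple_root C i | w <- Wl, i <- enum 'I_n].

Definition posroots (C : Mat) (Wl : seq Mat) : seq Lam :=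
  [seq b <- roots C Wl | pb (pos_root C b)].

Definition betas (C : Mat) (s : seq 'I_n) : seq Lam :=
  map (fun p => wordmx C (take p.1 s) *m simple_root C p.2) (zip (iota 0 (size s)) s).

Fixpoint masks (l : nat) : seq bitseq :=
  if l is l'.+1 then [seq b :: m | b <- [:: false; true], m <- masks l']
  else [:: [::]].

Section Ring.
(* K plays the role of Q: a commutative ring, an algebra over R = Z[t]
   via t, with elements x_lambda and a W-action (see the hypotheses below). *)
Variables (K : comUnitRingType) (t : K) (x : Lam -> K) (act : Mat -> K -> K).

Definition fgl_ok : Prop :=
  x 0 = 0 /\ (forall l m, x (l + m) = x l + x m - t * x l * x m).

Definition act_ok (C : Mat) : Prop :=
  [/\ forall a, act 1%:M a = a,
      forall w w' a, inW C w -> inW C w' -> act (w *m w') a = act w (act w' a)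
    & forall w, inW C w ->
      [/\ forall a b, act w (a + b) = act w a + act w b,
          forall a b, act w (a * b) = act w a * act w b,
          act w 1 = 1, act w t = t
        & forall l, act w (x l) = x (w *m l)]].

Definition roots_invertible (C : Mat) : Prop :=
  forall a, is_root C a -> x a \is a GRing.unit.

(* Twisted group algebra Q_W: formal finite sums  sum q_k delta_{w_k},
   represented by lists of pairs (q_k, w_k); qcoef a u = coefficient of delta_u. *)
Definition QW := seq (K * Mat).
Definition qcoef (a : QW) (u : Mat) : K := \sum_(p <- a | p.2 == u) p.1.
Definition qmul (a b : QW) : QW :=
  [seq (p.1 * act p.2 q.1, p.2 *m q.2) | p <- a, q <- b].
Definition qscale (c : K) (a : QW) : QW := [seq (c * p.1, p.2) | p <- a].
Definition qone : QW := [:: (1, (1%:M : Mat))].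

Definition Xop (C : Mat) (i : 'I_n) : QW :=
  [:: ((x (simple_root C i))^-1, sref C i); (- (x (simple_root C i))^-1, (1%:M : Mat))].
Definition Yop (C : Mat) (i : 'I_n) : QW :=
  [:: ((x (- simple_root C i))^-1, (1%:M : Mat)); ((x (simple_root C i))^-1, sref C i)].

Definition Xword (C : Mat) (s : seq 'I_n) : QW := foldr (fun i a => qmul (Xop C i) a) qone s.
Definition Yword (C : Mat) (s : seq 'I_n) : QW := foldr (fun i a => qmul (Yop C i) a) qone s.

Definition Xbasis (C : Mat) (v : Mat) : QW := Xword C (rword C v).
Definition Ybasis (C : Mat) (v : Mat) : QW := Yword C (rword C v).

Definition coefs_in (B : Mat -> QW) (Wl : seq Mat) (a : QW) (c : Mat -> K) : Prop :=
  forall u, qcoef a u = qcoef (flatten [seq qscale (c v) (B v) | v <- undup Wl]) u.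

Definition bcoef (B : Mat -> QW) (Wl : seq Mat) (a : QW) : Mat -> K :=
  epsilon (inhabits (fun _ => 0)) (coefs_in B Wl a).

(* K^Y(v,w): coefficient of Y_v in R^Y_w = prod_k (1 - y_{beta_k} Y_{i_k}), the
   central left factor being expanded and then identified (y_lambda -> x_lambda). *)
Definition KY (C : Mat) (Wl : seq Mat) (v w : Mat) : K :=
  let s := rword C w in
  \sum_(m <- masks (size s))
     (\prod_(b <- mask m (betas C s)) (- x b)) * bcoef (Ybasis C) Wl (Yword C (mask m s)) v.

(* K^X(v,w): coefficient of X_v in R^X_w = prod_k (1 + y_{-beta_k} X_{i_k}) *)
Definition KX (C : Mat) (Wl : seq Mat) (v w : Mat) : K :=
  let s := rword C w in
  \sum_(m <- masks (size s))
     (\prod_(b <- mask m (betas C s)) x (- b)) * bcoef (Xbasis C) Wl (Xword C (mask m s)) v.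

Definition theta (C : Mat) (Wl : seq Mat) (w : Mat) : K :=
  \prod_(b <- posroots C Wl | pb (exists g, neg_root C g /\ b = w *m g))
     (1 - t * x b)^-1.

(* GKM model: functions W -> Q (defined on all matrices) *)
Definition GX (C : Mat) (i : 'I_n) (f : Mat -> K) : Mat -> K :=
  fun w => (f (w *m sref C i) - f w) * (x (w *m simple_root C i))^-1.
Definition GY (C : Mat) (i : 'I_n) (f : Mat -> K) : Mat -> K :=
  fun w => f w * (x (- (w *m simple_root C i)))^-1
         + f (w *m sref C i) * (x (w *m simple_root C i))^-1.

Definition zeta0 (C : Mat) (Wl : seq Mat) : Mat -> K :=
  fun w => if w == 1%:M then \prod_(a <- posroots C Wl) x (- a) else 0.

Definition zetaX (C : Mat) (Wl : seq Mat) (u : Mat) : Mat -> K :=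
  foldl (fun f i => GX C i f) (zeta0 C Wl) (rword C u).
Definition zetaY (C : Mat) (Wl : seq Mat) (u : Mat) : Mat -> K :=
  foldl (fun f i => GY C i f) (zeta0 C Wl) (rword C u).

Definition psi (C : Mat) (Wl : seq Mat) (w0 v w : Mat) : K :=
  zetaX C Wl (v *m w0) (w *m w0).
Definition xi (C : Mat) (Wl : seq Mat) (w0 v w : Mat) : K :=
  zetaY C Wl (v *m w0) (w *m w0).

End Ring.
End RootSystem.

(* Main.v *)
Require Import Defs.
From HB Require Import structures.
From mathcomp Require Import all_boot all_order all_algebra.
From mathcomp Require Import ring zify.
From Stdlib Require Import ClassicalEpsilon.
Set Implicit Arguments. Unset Strict Implicit. Unset Printing Implicit Defensive.
Import Order.TTheory GRing.Theory Num.Theory.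
Local Open Scope ring_scope.

(* Both sides satisfy the same recursion along right multiplication w -> w s_i.  Expanding
   the last factor of the root polynomial of a word (reduced or not) expresses
   K(v, w s_i) by K(v, w) and K(v s_i, w).  On the GKM side, let s_k = w0 s_i w0, so that
   w0 alpha_k = - alpha_i; if v s_i > v then v w0 s_k < v w0, and the class of v w0 is the
   operator of index k applied to the class of v s_i w0, which is the same relation.  At w = 1
   both sides are delta_{v,1}: the class of w0 takes at w0 the value
   prod x_{-alpha} * prod x_{-alpha}^{-1} = 1.

   The recursions need X_v and Y_v to be independent of the reduced word.  With u_b = 1/x_b
   the formal group law becomes u_{-a} = t - u_a and u_a u_b = u_{a+b} (u_a + u_b - t), and the
   rank two braid relations are polynomial consequences of these.  Finiteness of W enters
   through the invariant form sum_w w^T w, which makes the Cartan matrix injective and bounds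
   C i j * C j i by 3. *)

Lemma pbP (P : Prop) : reflect P (pb P).
Proof. by rewrite /pb; case: excluded_middle_informative => h; constructor. Qed.

(** * Simple reflections, words, length and reduced words *)

Section Reflections.
Variables (n : nat) (C : 'M[int]_n).
Implicit Types (i j k : 'I_n) (s r : seq 'I_n) (w v u : 'M[int]_n) (l b c : 'cV[int]_n).
Local Notation sr := (sref C).
Local Notation al := (simple_root C).

Lemma simple_rootE i : al i = C *m delta_mx i 0.
Proof. by rewrite /simple_root colE. Qed.

Lemma mulmx_sref i l : sr i *m l = l - l i 0 *: al i.
Proof.
apply/colP => j; rewrite !mxE (bigD1 i) //= !mxE eqxx mulr1.
have [->|neq_ji] := eqVneq j i.
  rewrite big1 ?addr0; first by rewrite mulrBl mul1r [C _ _ * _]mulrC.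
  by move=> k neq_ki; rewrite !mxE eq_sym (negPf neq_ki) mulr0 subr0 mul0r.
rewrite (bigD1 j) //= !mxE eqxx (negPf neq_ji) mulr0 subr0 mul1r big1.
  by rewrite sub0r addr0 addrC mulNr [C _ _ * _]mulrC.
move=> k /andP[neq_ki neq_kj].
by rewrite !mxE eq_sym (negPf neq_kj) (negPf neq_ki) mulr0 subr0 mul0r.
Qed.

Lemma wordmx_cat s r : wordmx C (s ++ r) = wordmx C s *m wordmx C r.
Proof. by elim: s => [|i s IH] /=; rewrite ?mul1mx // IH mulmxA. Qed.

Lemma wordmx_seq1 i : wordmx C [:: i] = sr i.
Proof. exact: mulmx1. Qed.

Lemma wordmx_rcons s i : wordmx C (rcons s i) = wordmx C s *m sr i.
Proof. by rewrite -cats1 wordmx_cat wordmx_seq1. Qed.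

Lemma inW1 : inW C 1%:M. Proof. by exists [::]. Qed.

Lemma inW_word s : inW C (wordmx C s). Proof. by exists s. Qed.

Lemma inW_sref i : inW C (sr i). Proof. by exists [:: i]; rewrite wordmx_seq1. Qed.

Lemma inW_mul w v : inW C w -> inW C v -> inW C (w *m v).
Proof. by case=> s -> [r ->]; rewrite -wordmx_cat; apply: inW_word. Qed.

Lemma inW_mul_sref w i : inW C w -> inW C (w *m sr i).
Proof. by move=> Ww; apply: inW_mul (inW_sref i). Qed.

Hint Resolve inW1 inW_word inW_sref : core.

Lemma is_root_simple i : is_root C (al i).
Proof. by exists 1%:M, i; rewrite mul1mx. Qed.

Lemma is_root_mul w b : inW C w -> is_root C b -> is_root C (w *m b).
Proof.
by move=> Ww [v [i [Wv ->]]]; exists (w *m v), i; rewrite mulmxA; split=> //; apply: inW_mul.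
Qed.

Hypothesis HC : cartan C.

Lemma cartan_diag i : C i i = 2. Proof. by case: HC. Qed.

Lemma simple_root_diag i : al i i 0 = 2.
Proof. by rewrite mxE cartan_diag. Qed.

Lemma mulmx_sref_root i : sr i *m al i = - al i.
Proof.
rewrite mulmx_sref simple_root_diag.
by apply/colP=> j; rewrite !mxE; ring.
Qed.

Lemma sref_root_pair i j : sr i *m al j = al j - C i j *: al i.
Proof. by rewrite mulmx_sref mxE. Qed.

Lemma eq_mulmx_col w v : (forall l, w *m l = v *m l) -> w = v.
Proof.
by move=> eq_wv; apply/matrixP=> i j; have /colP/(_ i) := eq_wv (delta_mx j 0); rewrite -!colE !mxE.
Qed.

Lemma sref2 i : sr i *m sr i = 1%:M.
Proof.
apply: eq_mulmx_col => l; rewrite -mulmxA !mulmx_sref mul1mx.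
by apply/colP=> j; rewrite !mxE cartan_diag; ring.
Qed.

Lemma srefK w i : w *m sr i *m sr i = w.
Proof. by rewrite -mulmxA sref2 mulmx1. Qed.

Lemma wordmx_rev_mul s : wordmx C (rev s) *m wordmx C s = 1%:M.
Proof.
elim: s => [|i s IH] /=; first by rewrite mulmx1.
by rewrite rev_cons wordmx_rcons mulmxA srefK.
Qed.

Lemma wordmx_mul_rev s : wordmx C s *m wordmx C (rev s) = 1%:M.
Proof. by rewrite -{1}(revK s) wordmx_rev_mul. Qed.

Lemma inW_inv w : inW C w -> exists v, [/\ inW C v, v *m w = 1%:M & w *m v = 1%:M].
Proof.
case=> s ->; exists (wordmx C (rev s)).
by rewrite wordmx_rev_mul wordmx_mul_rev.
Qed.

Lemma inW_mulIr w v u : inW C u -> v *m u = w *m u -> v = w.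
Proof.
case/inW_inv => u' [_ _ uu'] /(congr1 (mulmx^~ u')).
by rewrite -!mulmxA uu' !mulmx1.
Qed.

Lemma is_root_opp b : is_root C b -> is_root C (- b).
Proof.
case=> w [i [Ww ->]]; exists (w *m sr i), i; split; first exact: inW_mul_sref.
by rewrite -mulmxA mulmx_sref_root mulmxN.
Qed.

(** A shortest word exists: while some word for [w] is shorter, pass to it, the size bounding the
    number of passes. Hence the choice made in [rword] is meaningful. *)
Lemma rword_spec w : inW C w -> reduced C (rword C w) /\ wordmx C (rword C w) = w.
Proof.
case=> s0 Es0.
apply: (epsilon_spec (inhabits [::]) (fun s => reduced C s /\ wordmx C s = w)).
suff H m s : (size s <= m)%N -> wordmx C s = w -> exists r, reduced C r /\ wordmx C r = w.
  by apply: (H _ s0).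
elim: m s => [|m IH] s les Es.
  by exists s; split=> // r _; move: les; rewrite leqn0 => /eqP ->.
have [[r [lt_rs Er]]|nex] :=
  excluded_middle_informative (exists r, (size r < size s)%N /\ wordmx C r = w).
  by apply: (IH r) Er; rewrite -ltnS; apply: leq_trans lt_rs les.
exists s; split=> // r Er; rewrite leqNgt; apply/negP => lt_rs.
by apply: nex; exists r; rewrite Er.
Qed.

Local Notation len := (wlength C).

Lemma wordmx_rword w : inW C w -> wordmx C (rword C w) = w.
Proof. by case/rword_spec. Qed.

Lemma reduced_rword w : inW C w -> reduced C (rword C w).
Proof. by case/rword_spec. Qed.

Lemma wlength_le s : (len (wordmx C s) <= size s)%N.
Proof.
have [red_r Er] := rword_spec (inW_word s).
by apply: red_r; rewrite Er.
Qed.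

Lemma wlength_reduced s : reduced C s <-> len (wordmx C s) = size s.
Proof.
have [red_r Er] := rword_spec (inW_word s).
split=> [red_s | E r Er'].
  by apply/eqP; rewrite eqn_leq wlength_le red_s.
by rewrite -E -Er'; apply: wlength_le.
Qed.

Lemma wlength_mul w v : inW C w -> inW C v -> (len (w *m v) <= len w + len v)%N.
Proof.
move=> Ww Wv; rewrite -{1}(wordmx_rword Ww) -{1}(wordmx_rword Wv) -wordmx_cat.
by apply: leq_trans (wlength_le _) _; rewrite size_cat.
Qed.

Lemma wlength_mul_word w s : inW C w -> (len (w *m wordmx C s) <= len w + size s)%N.
Proof.
by move=> Ww; apply: leq_trans (wlength_mul Ww (inW_word s)) _; rewrite leq_add2l wlength_le.
Qed.

Lemma wlength_mul_sref w i : inW C w -> (len (w *m sr i) <= (len w).+1)%N.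
Proof. by move=> Ww; rewrite -(wordmx_seq1 i) -addn1; apply: wlength_mul_word. Qed.

Lemma wlength_sref_mul w i : inW C w -> (len w <= (len (w *m sr i)).+1)%N.
Proof.
by move=> Ww; rewrite -{1}(srefK w i); apply/wlength_mul_sref/inW_mul_sref.
Qed.

Lemma wlength1 : len 1%:M = 0%N.
Proof. by apply/eqP; rewrite -leqn0; apply: (wlength_le [::]). Qed.

Lemma reduced_rev s : reduced C s -> reduced C (rev s).
Proof.
move=> red_s r Er; rewrite size_rev -(size_rev r); apply: red_s.
apply: (inW_mulIr (inW_word (rev s))).
by rewrite wordmx_mul_rev -Er wordmx_rev_mul.
Qed.

(** Reversing a reduced word of [w] gives a reduced word of its inverse. *)
Lemma wlength_inv w v : inW C w -> v *m w = 1%:M -> len v = len w.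
Proof.
move=> Ww vw1; have Ev : v = wordmx C (rev (rword C w)).
  by apply: (inW_mulIr Ww); rewrite -{3}(wordmx_rword Ww) wordmx_rev_mul.
rewrite Ev; have /wlength_reduced -> := reduced_rev (reduced_rword Ww).
by rewrite size_rev.
Qed.

Lemma reduced_rcons s i : reduced C (rcons s i) -> reduced C s.
Proof.
move=> red_si r Er; rewrite -ltnS -(size_rcons s i) -(size_rcons r i).
by apply: red_si; rewrite !wordmx_rcons Er.
Qed.

Lemma wlength_last s i : reduced C (rcons s i) ->
  len (wordmx C (rcons s i)) = (len (wordmx C (rcons s i) *m sr i)).+1.
Proof.
move=> red_si; rewrite {2}wordmx_rcons srefK.
have /wlength_reduced -> := red_si; have /wlength_reduced -> := reduced_rcons red_si.
by rewrite size_rcons.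
Qed.

Lemma exists_descent w : inW C w -> w <> 1%:M -> exists i, len w = (len (w *m sr i)).+1.
Proof.
move=> Ww; have [] := rword_spec Ww; case/lastP: (rword C w) => [_ <- //|s i] red_si Es _.
by exists i; rewrite -Es wlength_last.
Qed.

End Reflections.

(** * The invariant form and its consequences for the Cartan matrix *)

Section FiniteType.
Variables (n : nat) (C : 'M[int]_n).
Hypothesis HC : cartan C.
Variable Wl : seq 'M[int]_n.
Hypothesis HW : forall w, inW C w <-> w \in Wl.
Implicit Types (i j k : 'I_n) (s r : seq 'I_n) (w v u : 'M[int]_n) (l m b c : 'cV[int]_n).
Local Notation sr := (sref C).
Local Notation al := (simple_root C).

(** The standard form averaged over W; [undup] makes each group element count once. *)
Definition gram : 'M[int]_n := \sum_(w <- undup Wl) w^T *m w.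
Definition ip l m : int := (l^T *m gram *m m) 0 0.

Lemma mem_undupW w : (w \in undup Wl) = pb (inW C w).
Proof. by rewrite mem_undup; apply/idP/pbP => /HW. Qed.

Lemma perm_undupW v : inW C v -> perm_eq [seq w *m v | w <- undup Wl] (undup Wl).
Proof.
move=> Wv; have [v' [Wv' v'v vv']] := inW_inv HC Wv.
have mulIv : injective (fun w => w *m v).
  by move=> w u /=; apply: (inW_mulIr HC Wv).
apply: uniq_perm; rewrite ?map_inj_uniq ?undup_uniq //.
move=> w; rewrite mem_undupW; apply/mapP/pbP => [[u]|Ww].
  by rewrite mem_undupW => /pbP Wu ->; apply: inW_mul.
exists (w *m v'); last by rewrite -mulmxA v'v mulmx1.
by rewrite mem_undupW; apply/pbP/inW_mul.
Qed.

Lemma ip_inv v l m : inW C v -> ip (v *m l) (v *m m) = ip l m.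
Proof.
move=> Wv; suff E : v^T *m gram *m v = gram by rewrite /ip -[in RHS]E trmx_mul !mulmxA.
rewrite /gram -[in RHS](perm_big _ (perm_undupW Wv)) big_map /= mulmx_sumr mulmx_suml.
by apply: eq_bigr => w _; rewrite trmx_mul !mulmxA.
Qed.

Lemma ipC l m : ip l m = ip m l.
Proof.
have E : gram^T = gram.
  by rewrite /gram raddf_sum; apply: eq_bigr => w _ /=; rewrite trmx_mul trmxK.
transitivity ((l^T *m gram *m m)^T 0 0); first by rewrite mxE.
by rewrite !trmx_mul trmxK E mulmxA.
Qed.

Lemma ipDr l m b : ip l (m + b) = ip l m + ip l b.
Proof. by rewrite /ip mulmxDr mxE. Qed.
Lemma ipNr l m : ip l (- m) = - ip l m.
Proof. by rewrite /ip mulmxN mxE. Qed.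
Lemma ipZr l a m : ip l (a *: m) = a * ip l m.
Proof. by rewrite /ip -scalemxAr mxE. Qed.
Lemma ipDl l m b : ip (m + b) l = ip m l + ip b l.
Proof. by rewrite ipC ipDr !(ipC l). Qed.
Lemma ipNl l m : ip (- m) l = - ip m l.
Proof. by rewrite ipC ipNr (ipC l). Qed.
Lemma ipZl l a m : ip (a *: m) l = a * ip m l.
Proof. by rewrite ipC ipZr (ipC l). Qed.
Lemma ip_sumr l (I : finType) (F : I -> 'cV_n) : ip l (\sum_i F i) = \sum_i ip l (F i).
Proof. by rewrite /ip mulmx_sumr summxE. Qed.

(** Each summand is the sum of the squared coordinates of [w *m l], and the summand of the identity
    is already positive. *)
Lemma ip_gt0 l : l != 0 -> 0 < ip l l.
Proof.
move=> l_neq0.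
have sqE w : (l^T *m (w^T *m w) *m l) 0 0 = \sum_j ((w *m l) j 0) ^+ 2.
  rewrite !mulmxA -trmx_mul -mulmxA mxE.
  by apply: eq_bigr => j _; rewrite mxE expr2.
have sq_ge0 w : 0 <= (l^T *m (w^T *m w) *m l) 0 0.
  by rewrite sqE; apply: sumr_ge0 => j _; apply: sqr_ge0.
rewrite /ip /gram mulmx_sumr mulmx_suml summxE.
have W1 : 1%:M \in undup Wl by rewrite mem_undupW; apply/pbP/inW1.
rewrite (bigD1_seq 1%:M) ?undup_uniq //=.
apply: ltr_wpDr; first by apply: sumr_ge0 => w _; apply: sq_ge0.
rewrite lt_neqAle sq_ge0 andbT eq_sym; apply: contra l_neq0.
rewrite sqE psumr_eq0 => [/allP l0|j _]; last exact: sqr_ge0.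
apply/eqP/colP => j; have := l0 j (mem_index_enum j).
by rewrite mul1mx sqrf_eq0 mxE => /eqP.
Qed.

Lemma simple_root_neq0 i : al i != 0.
Proof.
by apply/eqP => /colP/(_ i); rewrite simple_root_diag // mxE.
Qed.

(** Invariance under [s_i], which negates [al i] and subtracts [l i 0] times [al i] from [l]. *)
Lemma ip_simple l i : 2 * ip l (al i) = l i 0 * ip (al i) (al i).
Proof.
have := ip_inv l (al i) (inW_sref C i).
rewrite mulmx_sref_root // mulmx_sref ipNr ipDl ipNl ipZl => E.
by rewrite mulr_natl mulr2n -{1}E; ring.
Qed.

Lemma mulmx_simple c : C *m c = \sum_i c i 0 *: al i.
Proof.
by apply/colP=> j; rewrite summxE mxE; apply: eq_bigr => i _; rewrite !mxE mulrC.
Qed.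

Lemma cartan_ge0_ker c : (forall i, 0 <= c i 0) -> C *m c = 0 -> c = 0.
Proof.
(* [rho] is the sum of the fundamental weights: twice its product with [al i] is the squared norm of
   [al i], so pairing it with [C *m c = 0] leaves a vanishing sum of nonnegative terms. *)
move=> c_ge0 Cc0; pose rho : 'cV[int]_n := const_mx 1.
have : \sum_i c i 0 * ip (al i) (al i) = 0.
  transitivity (2 * ip rho (C *m c)); last by rewrite Cc0 /ip mulmx0 mxE mulr0.
  rewrite mulmx_simple ip_sumr mulr_sumr; apply: eq_bigr => i _.
  by rewrite ipZr mulrCA ip_simple mxE mul1r.
have g_gt0 i : 0 < ip (al i) (al i) by apply/ip_gt0/simple_root_neq0.
move/eqP; rewrite psumr_eq0 => [/allP c0|i _]; last by rewrite mulr_ge0 // ltW.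
apply/colP => i; have := c0 i (mem_index_enum i).
by rewrite mulf_eq0 (gt_eqF (g_gt0 i)) orbF mxE => /eqP.
Qed.

Lemma ip_simple_le0 i j : i != j -> ip (al i) (al j) <= 0.
Proof.
case: HC => _ C_le0 _ neq_ij.
have g_gt0 : 0 < ip (al j) (al j) by apply/ip_gt0/simple_root_neq0.
rewrite -(pmulr_rle0 _ (_ : 0 < 2)) // ip_simple pmulr_lle0 // mxE.
by apply: C_le0; rewrite eq_sym.
Qed.

(* The off-diagonal products of simple roots are nonpositive, so replacing a
   kernel vector by its entrywise absolute value cannot increase its norm. *)
Lemma cartan_inj c : C *m c = 0 -> c = 0.
Proof.
move=> Cc0; pose d : 'cV[int]_n := \col_i `|c i 0|.
suff Cd0 : C *m d = 0.
  have d_ge0 i : 0 <= d i 0 by rewrite mxE.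
  have /colP d0 := cartan_ge0_ker d_ge0 Cd0.
  by apply/colP=> i; have /eqP := d0 i; rewrite !mxE normr_eq0 => /eqP.
have normE (z : 'cV_n) : ip (C *m z) (C *m z) = \sum_i \sum_j z i 0 * z j 0 * ip (al i) (al j).
  rewrite {2}mulmx_simple ip_sumr exchange_big; apply: eq_bigr => j _ /=.
  rewrite ipZr ipC mulmx_simple ip_sumr mulr_sumr; apply: eq_bigr => i _.
  by rewrite ipZr ipC mulrA [z j 0 * _]mulrC.
apply/eqP/negPn/negP => /ip_gt0; apply/negP; rewrite -leNgt.
rewrite (le_trans _ (_ : ip (C *m c) (C *m c) <= 0)) //; last by rewrite Cc0 /ip mulmx0 mxE.
rewrite !normE; apply: ler_sum => i _; apply: ler_sum => j _; rewrite !mxE.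
have [->|neq_ij] := eqVneq i j.
  by rewrite -normrM ger0_norm // -expr2 sqr_ge0.
by rewrite ler_wnM2r ?ip_simple_le0 // -normrM ler_norm.
Qed.

(** The vector [v] is twice the component of [al j] orthogonal to [al i]. Its squared norm is
    [4 - C i j * C j i] times that of [al j], and it is nonzero since [C] is injective. *)
Lemma cartan_prod_lt4 i j : i != j -> C i j * C j i < 4.
Proof.
move=> neq_ij.
have g_gt0 : 0 < ip (al j) (al j) by apply/ip_gt0/simple_root_neq0.
pose v := - C i j *: al i + 2 *: al j.
have v_neq0 : v != 0.
  apply/eqP => v0; pose d : 'cV[int]_n := - C i j *: delta_mx i 0 + 2 *: delta_mx j 0.
  have : C *m d = 0 by rewrite -v0 /v !simple_rootE !scalemxAr -mulmxDr.
  move/cartan_inj/colP/(_ j); rewrite !mxE !eqxx eq_sym (negPf neq_ij) /=.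
  by rewrite mulr0 add0r.
have := ip_gt0 v_neq0.
have := ip_simple (al i) j; have := ip_simple (al j) i.
rewrite !mxE [ip (al j) (al i)]ipC => E1 E2.
rewrite /v !ipDl !ipDr !ipZl !ipZr [ip (al j) (al i)]ipC.
suff -> : - C i j * (- C i j * ip (al i) (al i)) + - C i j * (2 * ip (al i) (al j))
   + (2 * (- C i j * ip (al i) (al j)) + 2 * (2 * ip (al j) (al j)))
   = (4 - C i j * C j i) * ip (al j) (al j).
  by rewrite pmulr_lgt0 // subr_gt0.
have E3 : C j i * ip (al j) (al j) = C i j * ip (al i) (al i) by rewrite -E1 -E2.
transitivity (C i j * (C i j * ip (al i) (al i)) - C i j * (2 * ip (al i) (al j)) *+ 2 + 4 * ip (al j) (al j)).
  by ring.
by rewrite E2 -E3; ring.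
Qed.

Lemma cartan_cases i j : i != j ->
  [\/ C i j = 0 /\ C j i = 0, C i j = -1 /\ C j i = -1,
      C i j = -1 /\ (C j i = -2 \/ C j i = -3)
    | C j i = -1 /\ (C i j = -2 \/ C i j = -3)].
Proof.
move=> neq_ij; have := cartan_prod_lt4 neq_ij.
case: HC => _ C_le0 C_eq0; have := C_eq0 i j; have := C_le0 _ _ neq_ij.
have neq_ji : j != i by rewrite eq_sym.
have := C_le0 _ _ neq_ji.
move: (C i j) (C j i) => a b b_le0 a_le0 ab0 ab_lt4.
have [a0|a_neq0] := eqVneq a 0.
  by constructor 1; split=> //; apply/eqP; rewrite -ab0 a0.
have a_lt0 : a < 0 by rewrite lt_neqAle a_neq0.
have b_lt0 : b < 0 by rewrite lt_neqAle -ab0 a_neq0.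
have [->|a_neq1] := eqVneq a (-1).
  have : b = -1 \/ b = -2 \/ b = -3 by lia.
  by case=> [->|h]; [constructor 2 | constructor 3].
have Eb : b = -1 by nia.
by constructor 4; split=> //; lia.
Qed.

End FiniteType.

(** * Alternating words in two letters; length against the sign of roots *)

Fixpoint altw (T : Type) (k : nat) (i j : T) : seq T :=
  if k is k'.+1 then i :: altw k' j i else [::].

Lemma size_altw (T : Type) k (i j : T) : size (altw k i j) = k.
Proof. by elim: k i j => //= k IH i j; rewrite IH. Qed.

Lemma altw_rcons (T : Type) k (i j : T) :
  altw k.+1 i j = rcons (altw k i j) (if odd k then j else i).
Proof. by elim: k i j => //= k IH i j; congr (_ :: _); rewrite IH /= if_neg. Qed.

Section Dihedral.
Variables (n : nat) (C : 'M[int]_n).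
Hypothesis HC : cartan C.
Variable Wl : seq 'M[int]_n.
Hypothesis HW : forall w, inW C w <-> w \in Wl.
Implicit Types (i j : 'I_n) (k m : nat) (s r : seq 'I_n) (w v u : 'M[int]_n) (l b c : 'cV[int]_n).
Local Notation sr := (sref C).
Local Notation al := (simple_root C).
Local Notation len := (wlength C).

(** The cone condition of [pos_root] without the requirement to be a root, so that it is stable
    under nonnegative combinations. *)
Definition qpos b := exists c, (forall i, 0 <= c i 0) /\ b = C *m c.

Lemma qpos_comb b b' (x y : int) :
  0 <= x -> 0 <= y -> qpos b -> qpos b' -> qpos (x *: b + y *: b').
Proof.
move=> x0 y0 [c [c0 ->]] [c' [c'0 ->]]; exists (x *: c + y *: c'); split.
  by move=> i; rewrite !mxE addr_ge0 // mulr_ge0.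
by rewrite mulmxDr -!scalemxAr.
Qed.

Lemma qpos_simple i : qpos (al i).
Proof.
exists (delta_mx i 0); split; last exact: simple_rootE.
by move=> j; rewrite mxE ler0n.
Qed.

Lemma sref_comb i j (x y : int) :
  sr i *m (x *: al i + y *: al j) = (- C i j * y - x) *: al i + y *: al j.
Proof.
rewrite mulmxDr -!scalemxAr mulmx_sref_root // sref_root_pair.
by apply/colP=> k; rewrite !mxE; ring.
Qed.

(* Coordinates, in the pair of simple roots (i, j), of the root obtained by applying
   the alternating word starting with i to the simple root that is not its last letter. *)
Fixpoint altcoord (k : nat) (p q : int) : int * int :=
  if k is k'.+1 then let: (y, x) := altcoord k' q p in (p * y - x, y) else (1, 0).

Lemma altcoordE k i j : wordmx C (altw k i j) *m al (if odd k then j else i) =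
  (altcoord k (- C i j) (- C j i)).1 *: al i + (altcoord k (- C i j) (- C j i)).2 *: al j.
Proof.
elim: k i j => [|k IH] i j; first by rewrite /= mul1mx scale1r scale0r addr0.
rewrite /= if_neg -mulmxA IH.
by case: (altcoord _ _ _) => y x /=; rewrite addrC sref_comb.
Qed.

(** The braid relation of length [m], together with nonnegativity of the roots met before full
    length. Both starting letters are included to keep the notion symmetric. *)
Definition dihedral i j (m : nat) :=
  [/\ (0 < m)%N, wordmx C (altw m i j) = wordmx C (altw m j i) &
  forall k, (k < m)%N ->
    [/\ 0 <= (altcoord k (- C i j) (- C j i)).1, 0 <= (altcoord k (- C i j) (- C j i)).2,
        0 <= (altcoord k (- C j i) (- C i j)).1 & 0 <= (altcoord k (- C j i) (- C i j)).2]].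

Lemma dihedral_sym i j m : dihedral i j m -> dihedral j i m.
Proof. by case=> m0 E H; split=> // k /H[]; split. Qed.

Lemma sref_affine i j l (x y : int) :
  sr i *m (l + (x *: al i + y *: al j)) = l + ((- C i j * y - x - l i 0) *: al i + y *: al j).
Proof.
rewrite mulmxDr sref_comb mulmx_sref.
by apply/colP=> k; rewrite !mxE; ring.
Qed.

(** The types A1 x A1, A2, B2 and G2. Double and triple bonds are listed in one orientation; the
    other one is [coxeter_type j i m]. *)
Definition coxeter_type i j m := exists p q : int, [/\ C i j = - p, C j i = - q &
  [|| [&& p == 0, q == 0 & m == 2], [&& p == 1, q == 1 & m == 3],
      [&& p == 1, q == 2 & m == 4] | [&& p == 1, q == 3 & m == 6]]%N].

(** Both alternating words add to [l] a combination of [al i] and [al j] whose coefficients are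
    linear in [l i 0] and [l j 0]; these are compared type by type. Nonnegativity is a check of at
    most six values of [k]. *)
Lemma dihedral_coxeter i j m : coxeter_type i j m -> dihedral i j m.
Proof.
case=> p [q [Cij Cji Hm]]; split; [by case/or4P: Hm => /and3P[_ _ /eqP->] | | ]; last first.
  rewrite Cij Cji !opprK => k.
  by case/or4P: Hm => /and3P[/eqP-> /eqP-> /eqP->]; do 7![case: k => [|k] //=].
apply: eq_mulmx_col => l.
have E0 : l = l + (0 *: al i + 0 *: al j) by rewrite !scale0r !addr0.
have Ei (x y : int) :
    sr i *m (l + (x *: al i + y *: al j)) = l + ((p * y - x - l i 0) *: al i + y *: al j).
  by rewrite sref_affine Cij opprK.
have Ej (x y : int) :
    sr j *m (l + (x *: al i + y *: al j)) = l + (x *: al i + (q * x - y - l j 0) *: al j).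
  by rewrite [x *: _ + _]addrC sref_affine Cji opprK addrC [in RHS]addrC [_ *: al j + _]addrC.
have Eq2 (x y x' y' : int) : x = x' -> y = y' ->
    l + (x *: al i + y *: al j) = l + (x' *: al i + y' *: al j) by move=> -> ->.
case/or4P: Hm => /and3P[/eqP Ep /eqP Eq /eqP->].
all: rewrite /= !mulmx1 -!mulmxA [l in LHS]E0 [l in RHS]E0.
all: rewrite !(Ei, Ej) Ep Eq.
all: apply: Eq2.
all: move: (l i 0) (l j 0) => y z; lia.
Qed.

Lemma coxeter_exists i j : i != j -> exists m, coxeter_type i j m \/ coxeter_type j i m.
Proof.
case/(cartan_cases HC HW).
- by case=> Cij Cji; exists 2%N; left; exists 0, 0.
- by case=> Cij Cji; exists 3%N; left; exists 1, 1.
- case=> Cij [] Cji; first by exists 4%N; left; exists 1, 2.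
  by exists 6%N; left; exists 1, 3.
case=> Cji [] Cij; first by exists 4%N; right; exists 1, 2.
by exists 6%N; right; exists 1, 3.
Qed.

Lemma dihedral_exists i j : i != j -> exists m, dihedral i j m.
Proof.
case/coxeter_exists => m [] /dihedral_coxeter; first by exists m.
by move/dihedral_sym; exists m.
Qed.

Lemma qpos_alt i j m k v : dihedral i j m -> (k < m)%N ->
  qpos (v *m al i) -> qpos (v *m al j) ->
  qpos (v *m wordmx C (altw k i j) *m al (if odd k then j else i)).
Proof.
case=> _ _ H /H[x0 y0 _ _] qi qj.
by rewrite -mulmxA altcoordE mulmxDr -!scalemxAr; apply: qpos_comb.
Qed.

Lemma alt_first_ascent i j k v : inW C v ->
  len (v *m wordmx C (altw k.+1 i j)) = (len v + k.+1)%N -> (len v <= len (v *m sr i))%N.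
Proof.
move=> Wv E; rewrite leqNgt; apply/negP => lt_v.
have := wlength_mul_word (altw k j i) (inW_mul_sref i Wv).
by rewrite -mulmxA; move: E => /= ->; rewrite size_altw; lia.
Qed.

Lemma alt_last_descent i j k v : inW C v ->
  len (v *m wordmx C (altw k.+1 i j)) = (len v + k.+1)%N ->
  (len (v *m wordmx C (altw k.+1 i j) *m sr (if odd k then j else i))
     < len (v *m wordmx C (altw k.+1 i j)))%N.
Proof.
move=> Wv E; rewrite E altw_rcons wordmx_rcons mulmxA srefK //.
have := wlength_mul_word (altw k i j) Wv; rewrite size_altw; lia.
Qed.

(** A descent of the left factor moves into the alternating word, which grows by one letter while
    lengths stay additive. *)
Lemma alt_extend i j k v : inW C v ->
  len (v *m wordmx C (altw k i j)) = (len v + k)%N -> (len (v *m sr j) < len v)%N ->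
  v *m sr j *m wordmx C (altw k.+1 j i) = v *m wordmx C (altw k i j) /\
  len (v *m wordmx C (altw k i j)) = (len (v *m sr j) + k.+1)%N.
Proof.
move=> Wv E lt_v; rewrite /= mulmxA srefK //; split=> //.
by have := wlength_sref_mul HC j Wv; lia.
Qed.

(** Induction on the length. A descent [j] of [w] differs from [i]; split off on the right of [w] an
    alternating word in [i] and [j], as long as possible with lengths adding up. The remaining
    factor [v] is shorter and has neither letter as a descent, so it keeps [al i] and [al j]
    positive, and [w *m al i] is a nonnegative combination of their images. *)
Lemma qpos_ascent w i : inW C w -> (len w <= len (w *m sr i))%N -> qpos (w *m al i).
Proof.
move: {2}(len w).+1 (ltnSn (len w)) => N.
elim: N w i => // N IH w i lt_wN Ww asc_i.
have [->|/eqP w_neq1] := eqVneq w 1%:M; first by rewrite mul1mx; apply: qpos_simple.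
have [j desc_j] := exists_descent HC Ww w_neq1.
have neq_ij : i != j.
  by apply/eqP => E; move: asc_i; rewrite E desc_j ltnn.
have [m dih] := dihedral_exists neq_ij.
have [m_gt0 Em _] := dih.
suff H d k e e' v : (m - k <= d)%N -> (k < m)%N ->
    (e = i /\ e' = j) \/ (e = j /\ e' = i) -> inW C v ->
    w = v *m wordmx C (altw k.+1 e e') -> len w = (len v + k.+1)%N -> qpos (w *m al i).
  apply: (H _ 0%N j i (w *m sr j) (leqnn _)) => //; first by right.
  - exact: inW_mul_sref.
  - by rewrite /= mulmx1 srefK.
  by rewrite addn1.
elim: d k e e' v => [|d IHd] k e e' v le_d lt_km ee' Wv Ew lw; first by move: le_d lt_km; lia.
have dih_e : dihedral e e' m by case: ee' => -[-> ->] //; apply: dihedral_sym.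
have last_not_i : (if odd k then e' else e) <> i.
  move=> E; have := @alt_last_descent e e' k v Wv; rewrite -Ew lw E => /(_ erefl).
  by rewrite -lw ltnNge asc_i.
have other_i : (if odd k.+1 then e' else e) = i.
  by move: last_not_i; case: ee' => -[-> ->] /=; case: (odd k).
(* At full length [m] the braid relation would rewrite the alternating word so that it ends in [i],
   making [i] a descent of [w]. *)
have lt_Skm : (k.+1 < m)%N.
  rewrite ltn_neqAle lt_km andbT; apply/eqP => Ekm.
  have Ew' : w = v *m wordmx C (altw k.+1 e' e).
    by rewrite Ew Ekm; congr (_ *m _); case: dih_e.
  have := @alt_last_descent e' e k v Wv; rewrite -Ew' lw => /(_ erefl).
  by move: other_i; rewrite /= if_neg => ->; rewrite -lw ltnNge asc_i.
have lt_vN : (len v < N)%N by move: lw lt_wN; lia.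
have [lt_ve|le_ve] := ltnP (len (v *m sr e')) (len v).
  have [|E1 E2] := @alt_extend e e' k.+1 v Wv _ lt_ve; first by rewrite -Ew.
  apply: (IHd k.+1 e' e (v *m sr e')) => //.
  - by move: le_d lt_km; lia.
  - by case: ee' => -[-> ->]; [right | left].
  - exact: inW_mul_sref.
  - by rewrite E1.
  by rewrite Ew.
rewrite Ew -other_i; apply: (qpos_alt dih_e) => //; apply: IH => //.
by apply: (@alt_first_ascent e e' k) => //; rewrite -Ew.
Qed.

(** The coefficient vectors of [b] and [- b] add up to a nonnegative vector in the kernel of [C],
    hence to zero. *)
Lemma qpos_opp b : qpos b -> qpos (- b) -> b = 0.
Proof.
move=> [c [c0 Eb]] [d [d0 Eb']].
have cd0 : c + d = 0.
  apply: (cartan_ge0_ker HC HW); last by rewrite mulmxDr -Eb -Eb' subrr.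
  by move=> i; rewrite mxE addr_ge0.
rewrite Eb (_ : c = 0) ?mulmx0 //; apply/colP=> i.
have /colP/(_ i)/eqP := cd0; rewrite !mxE paddr_eq0 //.
by case/andP => /eqP.
Qed.

Lemma wordmx_root_neq0 w i : inW C w -> w *m al i != 0.
Proof.
move=> Ww; have [v [_ vw _]] := inW_inv HC Ww.
apply/eqP => /(congr1 (mulmx v)); rewrite mulmxA vw mul1mx mulmx0.
exact/eqP/simple_root_neq0.
Qed.

Lemma is_root_neq0 b : is_root C b -> b <> 0.
Proof. by case=> w [i [Ww ->]]; apply/eqP/wordmx_root_neq0. Qed.

Variant ascent_spec w i : bool -> Prop :=
| Ascent of len (w *m sr i) = (len w).+1 & qpos (w *m al i) & ~ qpos (- (w *m al i)) :
    ascent_spec w i true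
| Descent of len w = (len (w *m sr i)).+1 & qpos (- (w *m al i)) & ~ qpos (w *m al i) :
    ascent_spec w i false.

(** Equal lengths are impossible: both [w *m al i] and its opposite, the image of [al i] under
    [w *m sr i], would then be positive. *)
Lemma ascentP w i : inW C w -> ascent_spec w i (len w < len (w *m sr i))%N.
Proof.
move=> Ww; have Wwi := inW_mul_sref i Ww.
have wi_neq0 := wordmx_root_neq0 i Ww.
have E : w *m sr i *m al i = - (w *m al i) by rewrite -mulmxA mulmx_sref_root // mulmxN.
have le1 := wlength_mul_sref i Ww; have le2 := wlength_sref_mul HC i Ww.
have posN : qpos (w *m al i) -> ~ qpos (- (w *m al i)).
  by move=> q1 /(qpos_opp q1)/eqP; rewrite (negPf wi_neq0).
have [lt_w|le_w] := ltnP; constructor.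
- by apply/eqP; rewrite eqn_leq le1.
- by apply: qpos_ascent => //; apply: ltnW.
- by apply/posN/qpos_ascent => //; apply: ltnW.
- apply/eqP; rewrite eqn_leq le2 ltn_neqAle le_w andbT; apply/eqP => El.
  apply: (posN); first by apply: qpos_ascent => //; rewrite El.
  by rewrite -E; apply: qpos_ascent => //; rewrite srefK // El.
- by rewrite -E; apply: qpos_ascent => //; rewrite srefK.
by move=> /posN; apply; rewrite -E; apply: qpos_ascent => //; rewrite srefK.
Qed.

End Dihedral.

(** * Inversion sets and the longest element *)

Section Inversions.
Variables (n : nat) (C : 'M[int]_n).
Hypothesis HC : cartan C.
Variable Wl : seq 'M[int]_n.
Hypothesis HW : forall w, inW C w <-> w \in Wl.
Implicit Types (i j : 'I_n) (s r : seq 'I_n) (w v u : 'M[int]_n) (l b c : 'cV[int]_n).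
Local Notation sr := (sref C).
Local Notation al := (simple_root C).
Local Notation len := (wlength C).
Local Notation qpos := (qpos C).
Local Notation ascentP := (ascentP HC HW).
#[local] Hint Resolve inW1 inW_word inW_sref is_root_simple : core.

Lemma pos_root_simple i : pos_root C (al i).
Proof. by split; [apply: is_root_simple | apply: qpos_simple]. Qed.

Lemma root_pos_neg b : is_root C b -> pos_root C b \/ neg_root C b.
Proof.
move=> Rb; have RNb := is_root_opp HC Rb.
by case: (Rb) => w [i [Ww Eb]]; case: (ascentP i Ww); rewrite -Eb; [left | right].
Qed.

Lemma pos_root_not_neg b : pos_root C b -> ~ neg_root C b.
Proof. by move=> [Rb pb] [_ nb]; apply: (is_root_neq0 HC Rb); apply: (qpos_opp HC HW). Qed.

Lemma betas_rcons s i : betas C (rcons s i) = rcons (betas C s) (wordmx C s *m al i).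
Proof.
rewrite /betas size_rcons -[(size s).+1]addn1 iotaD add0n cats1 zip_rcons ?size_iota // map_rcons /=.
congr rcons; last by rewrite -cats1 take_size_cat.
apply/eq_in_map => -[a j] /(map_f fst); rewrite /= -/unzip1 unzip1_zip ?size_iota //.
by rewrite mem_iota => /andP[_ lt_a]; rewrite -cats1 takel_cat // ltnW.
Qed.

Lemma betas_cons i s : betas C (i :: s) = al i :: [seq sr i *m b | b <- betas C s].
Proof.
elim/last_ind: s => [|s j IH]; first by rewrite /betas /= mul1mx.
by rewrite -rcons_cons !betas_rcons IH map_rcons rcons_cons /= mulmxA.
Qed.

Lemma is_root_betas s b : b \in betas C s -> is_root C b.
Proof.
elim/last_ind: s => // s i IH; rewrite betas_rcons mem_rcons inE => /orP[/eqP->|/IH //].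
by apply: is_root_mul (is_root_simple C i).
Qed.

(** The reflection changes only the coefficient of [al i]. If the image is negative, all other
    coefficients of [b] vanish and [b] is a multiple of [al i]; the multiple is then shown to be
    1. *)
Lemma sref_pos_root i b : pos_root C b -> b = al i \/ pos_root C (sr i *m b).
Proof.
move=> [Rb [c [c_ge0 Ec]]].
have Rsb := is_root_mul (inW_sref C i) Rb.
have [|[_ [d [d_ge0 Ed]]]] := root_pos_neg Rsb; first by right.
left; have cd0 : c - b i 0 *: delta_mx i 0 + d = 0.
  apply: (cartan_inj HC HW); rewrite mulmxDr mulmxBr -scalemxAr -simple_rootE -Ec -Ed.
  by rewrite mulmx_sref subrr.
have Ec1 : c = c i 0 *: delta_mx i 0.
  apply/colP => j; rewrite !mxE eqxx andbT; have [->|neq_ji] := eqVneq j i; first by rewrite mulr1.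
  have /colP/(_ j) := cd0; rewrite !mxE (negPf neq_ji) mulr0 subr0 => /eqP.
  by rewrite paddr_eq0 // mulr0 => /andP[/eqP].
have Eb : b = c i 0 *: al i by rewrite {1}Ec {1}Ec1 -scalemxAr -simple_rootE.
have [u [k [Wu Eu]]] := Rb; have [u' [Wu' u'u _]] := inW_inv HC Wu.
(* [b] is conjugate to a simple root [al k], so [al k] is [c i 0] times an integral combination of
   simple roots; comparing coefficients of [al k] makes [c i 0] a unit of the integers. *)
suff [z Ez] : exists z, c i 0 * z = 1.
  rewrite Eb (_ : c i 0 = 1) ?scale1r //; have := c_ge0 i.
  by move/(congr1 absz)/eqP: Ez; rewrite abszM muln_eq1 => /andP[/eqP ? _]; lia.
have Ek : al k = c i 0 *: (u' *m al i) by rewrite scalemxAr -Eb Eu mulmxA u'u mul1mx.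
have R' : is_root C (u' *m al i) by apply: is_root_mul (is_root_simple C i).
have [z Ez] : exists z, u' *m al i = C *m z.
  case: (root_pos_neg R') => -[_ [z [_ Ez]]]; first by exists z.
  by exists (- z); rewrite mulmxN -Ez opprK.
exists (z k 0); have : C *m (c i 0 *: z - delta_mx k 0) = 0.
  by rewrite mulmxBr -scalemxAr -Ez -Ek -simple_rootE subrr.
by move/(cartan_inj HC HW)/colP/(_ k)/eqP; rewrite !mxE !eqxx subr_eq0 => /eqP.
Qed.

(** Induction on the last letter: the new root [w *m al i] is positive because the word is reduced,
    and [s_i] moves no positive root except [al i] to a negative one. The reversed word is the
    inverse. *)
Lemma betas_inversions s : reduced C s ->
  uniq (betas C s) /\
  forall b, b \in betas C s <-> pos_root C b /\ neg_root C (wordmx C (rev s) *m b).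
Proof.
elim/last_ind: s => [_|s i IH red_si].
  split=> // b; rewrite mul1mx; split=> [//|[p1 p2]].
  by case: (pos_root_not_neg p1).
have red_s := reduced_rcons red_si; have [Us Ms] := IH red_s.
set w := wordmx C s in Ms *; set v := wordmx C (rev s) in Ms *.
have Ww : inW C w by apply: inW_word.
have Wv : inW C v by apply: inW_word.
have vw : v *m w = 1%:M by apply: wordmx_rev_mul.
have wv : w *m v = 1%:M by apply: wordmx_mul_rev.
have pos_wi : pos_root C (w *m al i).
  split; first by apply: is_root_mul (is_root_simple C i).
  have := wlength_last HC red_si; rewrite wordmx_rcons srefK // => E.
  case: (ascentP i Ww) => // El _ _; exfalso; move: El; rewrite [len (w *m _)]E -/w; lia.
rewrite betas_rcons rev_rcons /= -/v; split=> [|b].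
  rewrite rcons_uniq Us andbT; apply/negP => /Ms[_].
  by rewrite mulmxA vw mul1mx; apply/pos_root_not_neg/pos_root_simple.
rewrite mem_rcons inE -mulmxA; split.
  case/orP=> [/eqP->|/Ms[pb nvb]].
    split=> //; rewrite [v *m _]mulmxA vw mul1mx mulmx_sref_root // /neg_root opprK.
    exact: pos_root_simple.
  split=> //; case: (sref_pos_root i nvb) => [E|]; last by rewrite mulmxN.
  case: (pos_root_not_neg pos_wi); rewrite /neg_root.
  by rewrite -E mulmxN opprK mulmxA wv mul1mx.
case=> pb nb; have Rvb : is_root C (v *m b) by apply: is_root_mul => //; case: pb.
case: (root_pos_neg Rvb) => [pvb|nvb]; last by apply/orP; right; apply/Ms.
case: (sref_pos_root i pvb) => [E|/pos_root_not_neg //].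
by rewrite -E mulmxA wv mul1mx eqxx.
Qed.

Lemma qpos_sum c w : (forall i, 0 <= c i 0) -> (forall i, qpos (w *m al i)) -> qpos (w *m (C *m c)).
Proof.
move=> c_ge0 qw; rewrite (mulmx_simple C) mulmx_sumr.
apply: (big_ind qpos) => [|b b' qb qb'|i _].
- by exists 0; split=> [i|]; rewrite ?mxE ?mulmx0.
- by rewrite -[b]scale1r -[b']scale1r; apply: qpos_comb.
rewrite -scalemxAr -[_ *: _]addr0 -(scale0r (al i)).
by apply: qpos_comb => //; apply: qpos_simple.
Qed.

Lemma neg_root_mul w b : inW C w -> (forall i, qpos (- (w *m al i))) ->
  pos_root C b -> neg_root C (w *m b).
Proof.
move=> Ww nw [Rb [c [c_ge0 Eb]]].
split; first by apply/(is_root_opp HC)/is_root_mul.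
by rewrite -mulNmx Eb; apply: qpos_sum => // i; rewrite mulNmx.
Qed.

Lemma pos_simple_eq1 w : inW C w -> (forall i, qpos (w *m al i)) -> w = 1%:M.
Proof.
move=> Ww pw; have [//|/eqP neq1] := eqVneq w 1%:M.
have [i Ei] := exists_descent HC Ww neq1.
case: (ascentP i Ww) => [El _ _|_ _ /(_ (pw i)) //].
by exfalso; move: Ei; rewrite El; lia.
Qed.

Lemma longest_neg w0 i : longest C w0 -> qpos (- (w0 *m al i)).
Proof.
case=> W0 max0; have := max0 _ (inW_mul_sref i W0).
by case: (ascentP i W0) => // ->; rewrite ltnn.
Qed.

Lemma longest_inv w0 v : longest C w0 -> v *m w0 = 1%:M -> inW C v -> longest C v.
Proof. by move=> [W0 max0] v0 Wv; split=> // w /max0; rewrite (wlength_inv HC W0 v0). Qed.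

(** The inverse of [w0] also negates all positive roots, so its product with [w] keeps every simple
    root positive and is the identity. *)
Lemma neg_simple_longest w0 w : longest C w0 -> inW C w ->
  (forall i, qpos (- (w *m al i))) -> w = w0.
Proof.
move=> L0 Ww nw; have [W0 _] := L0; have [v [Wv vw0 w0v]] := inW_inv HC W0.
have Lv := longest_inv L0 vw0 Wv.
have /pos_simple_eq1 E : forall i, qpos (v *m w *m al i).
  move=> i; rewrite -mulmxA -[w *m _]opprK mulmxN.
  have [] // := @neg_root_mul v (- (w *m al i)) Wv (fun i => longest_neg i Lv).
  by split; [apply/(is_root_opp HC)/is_root_mul | apply: nw].
by rewrite -[w]mul1mx -w0v -mulmxA E ?mulmx1 //; apply: inW_mul.
Qed.

(** The element [s_i w0] is one shorter than [w0], so it has an ascent [k], and [s_i w0 s_k] has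
    maximal length, hence equals [w0]. Comparing the two reflections gives [w0 *m al k] as an
    integer unit times [al i], and the sign is negative. *)
Lemma longest_conj w0 i : longest C w0 ->
  exists k, w0 *m sr k = sr i *m w0 /\ w0 *m al k = - al i.
Proof.
move=> L0; have [W0 max0] := L0; have [v [Wv vw0 w0v]] := inW_inv HC W0.
have Lv := longest_inv L0 vw0 Wv.
pose u := sr i *m w0; have Wu : inW C u by apply: inW_mul => //; apply: inW_sref.
have lu : (len u).+1 = len w0.
  have vu : (v *m sr i) *m u = 1%:M by rewrite /u mulmxA srefK.
  rewrite -(wlength_inv HC Wu vu) -(wlength_inv HC W0 vw0).
  case: (ascentP i Wv) => [_ q1 /(_ (longest_neg i Lv)) //|-> //].
have [k asc_k] : exists k, (len u < len (u *m sr k))%N.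
  have [/existsP //|/existsPn desc] := boolP [exists k, (len u < len (u *m sr k))%N].
  suff Eu : u = w0 by move: lu; rewrite Eu; lia.
  apply: neg_simple_longest => // k.
  by have := desc k; case: (ascentP k Wu).
have Euk : u *m sr k = w0.
  have Wuk := inW_mul_sref k Wu.
  have lmax : len (u *m sr k) = len w0.
    by apply/eqP; rewrite eqn_leq max0 //= -lu.
  apply: neg_simple_longest => // j; apply: longest_neg.
  by split=> // w /max0; rewrite lmax.
have Ek : w0 *m sr k = sr i *m w0 by rewrite -{1}Euk srefK.
exists k; split=> //.
(* Both sides of [Ek] subtract a vector from [w0 *m l]; evaluating at fundamental weights then
   yields the scalars [a] and [b]. *)
have El l : l k 0 *: (w0 *m al k) = (w0 *m l) i 0 *: al i.
  have := congr1 (mulmx^~ l) Ek; rewrite /= -!mulmxA !mulmx_sref mulmxBr -scalemxAr.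
  by move/addrI/oppr_inj.
pose a : int := (w0 *m (delta_mx k 0 : 'cV_n)) i 0.
have Ea : w0 *m al k = a *: al i by rewrite -El mxE !eqxx scale1r.
pose b : int := (v *m (delta_mx i 0 : 'cV_n)) k 0.
have Eb : b *: (w0 *m al k) = al i by rewrite El mulmxA w0v mul1mx mxE !eqxx scale1r.
have ab : b * a = 1.
  have /colP/(_ i) := Eb; rewrite Ea !mxE cartan_diag // => h; lia.
have [a1|aN1] : a = 1 \/ a = -1.
  by move/(congr1 absz)/eqP: ab; rewrite abszM muln_eq1 => /andP[_ /eqP ?]; lia.
  have := longest_neg k L0; rewrite Ea a1 scale1r => h.
  have /eqP := qpos_opp HC HW (qpos_simple C i) h.
  by rewrite (negPf (simple_root_neq0 HC i)).
by rewrite Ea aN1 scaleN1r.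
Qed.

End Inversions.

(** * Demazure operators: quadratic and rank two braid relations *)

Section Demazure.
Variables (n : nat) (C : 'M[int]_n).
Hypothesis HC : cartan C.
Variables (K : comUnitRingType) (t : K) (x : 'cV[int]_n -> K).
Hypotheses (Hfgl : fgl_ok t x) (Hunit : roots_invertible x C).
Implicit Types (i j : 'I_n) (s r : seq 'I_n) (w v : 'M[int]_n) (l b c : 'cV[int]_n).
Implicit Types (f g : 'M[int]_n -> K) (tau : K).
Local Notation sr := (sref C).
Local Notation al := (simple_root C).
Local Notation u b := (x b)^-1.

Lemma fgl_inv_opp b : is_root C b -> u (- b) = t - u b.
Proof.
move=> Rb; have Ub := Hunit Rb; have UNb := Hunit (is_root_opp HC Rb).
have [x0 xD] := Hfgl; have := xD b (- b); rewrite subrr x0.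
move/(congr1 (fun y => y * u b * u (- b))); rewrite !mul0r => E.
apply/eqP; rewrite -subr_eq0; apply/eqP; rewrite [RHS]E.
have E1 : x b * u b = 1 by rewrite divrr.
have E2 : x (- b) * u (- b) = 1 by rewrite divrr.
by ring: E1 E2.
Qed.

Lemma fgl_inv_add b c : is_root C b -> is_root C c -> is_root C (b + c) ->
  u b * u c = u (b + c) * (u b + u c - t).
Proof.
move=> /Hunit Ub /Hunit Uc /Hunit Ubc; have [_ xD] := Hfgl.
apply: (mulrI Ubc); rewrite [RHS]mulrA divrr // mul1r xD.
have E1 : x b * u b = 1 by rewrite divrr.
have E2 : x c * u c = 1 by rewrite divrr.
by ring: E1 E2.
Qed.

(* The operators X_i (tau = 0) and Y_i (tau = t) of the GKM model, in the form X_i + tau. *)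
Definition dem tau i f w : K := f (w *m sr i) * u (w *m al i) + f w * (tau - u (w *m al i)).
Definition dems tau f s : 'M[int]_n -> K := foldr (dem tau) f s.

Lemma dems_ext tau f g s : (forall w, inW C w -> f w = g w) ->
  forall w, inW C w -> dems tau f s w = dems tau g s w.
Proof.
move=> fg; elim: s => //= i s IH w Ww; rewrite /dem !IH //; exact: inW_mul_sref.
Qed.

(** The factor [2 * tau - t] is [- t] for [X_i] and [t] for [Y_i], so one formula covers both
    quadratic relations. *)
Lemma dem_quadratic tau f i w : tau * (tau - t) = 0 -> inW C w ->
  dem tau i (dem tau i f) w = (2 * tau - t) * dem tau i f w.
Proof.
move=> Htau Ww; rewrite /dem srefK // -[w *m sr i *m _]mulmxA mulmx_sref_root // mulmxN.
rewrite fgl_inv_opp; last exact/is_root_mul/is_root_simple.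
apply/eqP; rewrite -subr_eq0; apply/eqP; transitivity (f w * - (tau * (tau - t))); first by ring.
by rewrite Htau oppr0 mulr0.
Qed.

Section RankTwo.
Variables (i j : 'I_n) (w : 'M[int]_n) (f : 'M[int]_n -> K).
Hypothesis Ww : inW C w.
(** Indexing by coordinates turns the action of [s_i] and [s_j] into arithmetic on the pair [a],
    [b]. *)
Let U v (a b : int) := u (v *m (a *: al i + b *: al j)).
Let rt (a b : int) := is_root C (a *: al i + b *: al j).

Lemma rank2_sref_l v (a b : int) : U (v *m sr i) a b = U v (- C i j * b - a) b.
Proof. by rewrite /U -mulmxA sref_comb. Qed.

Lemma rank2_sref_r v (a b : int) : U (v *m sr j) a b = U v a (- C j i * a - b).
Proof. by rewrite /U -mulmxA [_ *: al i + _]addrC sref_comb // [in RHS]addrC. Qed.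

Lemma rank2_simple_l v : u (v *m al i) = U v 1%Z 0%Z.
Proof. by rewrite /U scale1r scale0r addr0. Qed.

Lemma rank2_simple_r v : u (v *m al j) = U v 0%Z 1%Z.
Proof. by rewrite /U scale1r scale0r add0r. Qed.

Lemma rank2_root_l : rt 1%Z 0%Z.
Proof. by rewrite /rt scale1r scale0r addr0; apply: is_root_simple. Qed.

Lemma rank2_root_r : rt 0%Z 1%Z.
Proof. by rewrite /rt scale1r scale0r add0r; apply: is_root_simple. Qed.

Lemma rank2_root_sref_l (a b : int) : rt a b -> rt (- C i j * b - a) b.
Proof. by move/(is_root_mul (inW_sref C i)); rewrite sref_comb. Qed.

Lemma rank2_root_sref_r (a b : int) : rt a b -> rt a (- C j i * a - b).
Proof. by move/(is_root_mul (inW_sref C j)); rewrite addrC sref_comb // addrC. Qed.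

Lemma rank2_opp (a b : int) : rt a b -> U w (- a) (- b) = t - U w a b.
Proof.
by move=> R; rewrite /U !scaleNr -opprD mulmxN; apply/fgl_inv_opp/is_root_mul.
Qed.

Lemma rank2_add (a b a' b' : int) : rt a b -> rt a' b' -> rt (a + a') (b + b') ->
  U w a b * U w a' b' = U w (a + a') (b + b') * (U w a b + U w a' b' - t).
Proof.
rewrite /rt /U !scalerDl addrACA !mulmxDr => r1 r2 r3.
have root_mul c : is_root C c -> is_root C (w *m c) by apply: is_root_mul.
by rewrite -!mulmxDr fgl_inv_add ?mulmxDr // -?mulmxDr; apply: root_mul.
Qed.

(** Evaluates the integer indices, so that equal roots become identical atoms for [ring]. *)
Ltac rank2_num := repeat match goal with |- context [U ?v ?a ?b] =>
  let a' := eval vm_compute in a in let b' := eval vm_compute in b in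
  progress change (U v a b) with (U v a' b') end.

(** Both sides expand into values of [f] at [w] times elements of the dihedral group of [s_i] and
    [s_j]. [Em] identifies the two expressions of its longest element, and the coefficients agree
    modulo the additivity relations between the inverses. *)
Lemma rank2_braid m tau : coxeter_type C i j m -> tau = 0 \/ tau = t ->
  dems tau f (altw m i j) w = dems tau f (altw m j i) w.
Proof.
move=> type_m tau_eq.
have [_ /(congr1 (mulmx w)) Em _] := dihedral_coxeter HC type_m.
case: type_m Em => p [q [Cij Cji Hm]].
have Ul v (a b : int) : U (v *m sr i) a b = U v (p * b - a) b.
  by rewrite rank2_sref_l Cij opprK.
have Ur v (a b : int) : U (v *m sr j) a b = U v a (q * a - b).
  by rewrite rank2_sref_r Cji opprK.
have Rl (a b : int) : rt a b -> rt (p * b - a) b.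
  by move/rank2_root_sref_l; rewrite Cij opprK.
have Rr (a b : int) : rt a b -> rt a (q * a - b).
  by move/rank2_root_sref_r; rewrite Cji opprK.
have r10 := rank2_root_l; have r01 := rank2_root_r.
have n10 : U w (-1)%Z 0%Z = t - U w 1%Z 0%Z := rank2_opp r10.
have n01 : U w 0%Z (-1)%Z = t - U w 0%Z 1%Z := rank2_opp r01.
case/or4P: Hm => /and3P[/eqP Ep /eqP Eq /eqP->]; rewrite Ep Eq in Ul Ur Rl Rr *;
  rewrite /= !mulmx1 !mulmxA => Em;
  rewrite /dems /= /dem !rank2_simple_l !rank2_simple_r !(Ul, Ur) ?srefK // Em; rank2_num.
- by rewrite ?n10 ?n01; case: tau_eq => ->; ring.
- have r11 : rt 1%Z 1%Z := Rl _ _ r01.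
  have n11 : U w (-1)%Z (-1)%Z = t - U w 1%Z 1%Z := rank2_opp r11.
  have Q : U w 1%Z 0%Z * U w 0%Z 1%Z = U w 1%Z 1%Z * (U w 1%Z 0%Z + U w 0%Z 1%Z - t).
    exact: rank2_add r10 r01 r11.
  by rewrite ?n10 ?n01 ?n11; case: tau_eq => ->; ring: Q.
- have r11 : rt 1%Z 1%Z := Rl _ _ r01.
  have r12 : rt 1%Z 2%Z := Rr _ _ r10.
  have n11 : U w (-1)%Z (-1)%Z = t - U w 1%Z 1%Z := rank2_opp r11.
  have n12 : U w (-1)%Z (-2)%Z = t - U w 1%Z 2%Z := rank2_opp r12.
  have T1 : U w 1%Z 0%Z * U w 0%Z 1%Z = U w 1%Z 1%Z * (U w 1%Z 0%Z + U w 0%Z 1%Z - t).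
    exact: rank2_add r10 r01 r11.
  have T2 : U w 1%Z 1%Z * U w 0%Z 1%Z = U w 1%Z 2%Z * (U w 1%Z 1%Z + U w 0%Z 1%Z - t).
    exact: rank2_add r11 r01 r12.
  (* Using additivity twice, the product at the two extreme roots becomes a sum of products of
     neighbours in the angular order 10, 11, 12, 01, with a correction by [t]. *)
  have Q : U w 1%Z 0%Z * U w 0%Z 1%Z = U w 1%Z 0%Z * U w 1%Z 1%Z + U w 1%Z 1%Z * U w 1%Z 2%Z
      + U w 1%Z 2%Z * U w 0%Z 1%Z - t * (U w 1%Z 1%Z + U w 1%Z 2%Z).
    by rewrite T1; ring: T2.
  by rewrite ?n10 ?n01 ?n11 ?n12; case: tau_eq => ->; ring: Q.
(* Type G2, with positive roots 10, 11, 23, 12, 13, 01 in angular order; five additivity relations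
   enter. *)
have r11 : rt 1%Z 1%Z := Rl _ _ r01.
have r12 : rt 1%Z 2%Z := Rr _ _ r11.
have r13 : rt 1%Z 3%Z := Rr _ _ r10.
have r23 : rt 2%Z 3%Z := Rl _ _ r13.
have n11 : U w (-1)%Z (-1)%Z = t - U w 1%Z 1%Z := rank2_opp r11.
have n12 : U w (-1)%Z (-2)%Z = t - U w 1%Z 2%Z := rank2_opp r12.
have n13 : U w (-1)%Z (-3)%Z = t - U w 1%Z 3%Z := rank2_opp r13.
have n23 : U w (-2)%Z (-3)%Z = t - U w 2%Z 3%Z := rank2_opp r23.
have := rank2_add r10 r01 r11; have := rank2_add r11 r01 r12.
have := rank2_add r12 r01 r13; have := rank2_add r10 r13 r23; have := rank2_add r11 r12 r23.
rank2_num; rewrite ?n10 ?n01 ?n11 ?n12 ?n13 ?n23.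
move: (U w 1%Z 0%Z) (U w 0%Z 1%Z) (U w 1%Z 1%Z) (U w 1%Z 2%Z) (U w 1%Z 3%Z) (U w 2%Z 3%Z).
move=> u10 u01 u11 u12 u13 u23 T5 T4 T3 T2 T1.
have Q : u10 * u01 = u10 * u11 + u11 * u23 + u23 * u12 + u12 * u13 + u13 * u01
    - t * (u11 + u23 + u12 + u13).
  have -> : u10 * u01 = u10 * u11 + u11 * u01 - t * u11 by rewrite T1; ring.
  have -> : u11 * u01 = u12 * u11 + u12 * u01 - t * u12 by rewrite T2; ring.
  by rewrite T3 [u12 * u11]mulrC T5; ring.
(* Each coefficient of the difference of the two sides lies in the ideal of [Q] and [R]. *)
have R : u12 ^+ 2 * u13 ^+ 2 = u01 * u11 * u13 ^+ 2 - u01 * u11 * u13 * t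
    - u01 * u12 * u13 ^+ 2 + u01 * u12 * u13 * t + u10 * u11 ^+ 2 * u13
    - u10 * u11 ^+ 2 * u23 - u10 * u11 * u13 * t + u10 * u11 * u23 * t
    + u11 ^+ 2 * u13 * u23 - u11 ^+ 2 * u13 * t - u11 ^+ 2 * u23 ^+ 2 + u11 ^+ 2 * u23 * t
    + u11 * u12 * u13 ^+ 2 - u11 * u12 * u13 * t - 2 * u11 * u12 * u23 ^+ 2
    + 2 * u11 * u12 * u23 * t - u11 * u13 ^+ 2 * t - u11 * u13 * u23 * t + u11 * u13 * t ^+ 2
    + 2 * u11 * u23 ^+ 2 * t - u11 * u23 * t ^+ 2 - 2 * u12 ^+ 2 * u13 * u23
    + 2 * u12 ^+ 2 * u13 * t - u12 ^+ 2 * u23 ^+ 2 + 2 * u12 ^+ 2 * u23 * t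
    - u12 ^+ 2 * t ^+ 2 + u12 * u13 ^+ 2 * t + 2 * u12 * u13 * u23 * t - u12 * u13 * t ^+ 2
    + 2 * u12 * u23 ^+ 2 * t - 2 * u12 * u23 * t ^+ 2 - u23 ^+ 2 * t ^+ 2.
  apply/eqP; rewrite -subr_eq0; apply/eqP.
  (* Explicit cofactors placing [R] in the ideal generated by [T2], [T3], [T4] and [T5]. *)
  transitivity (
      (u11 * u01 - u12 * (u11 + u01 - t)) * (- u11 * u12 + u11 * u13 - u12 * u13 + u12 * t)
    + (u12 * u01 - u13 * (u12 + u01 - t))
      * (u11 ^+ 2 - u11 * u12 + u11 * u13 - u11 * t - u12 * u13 + u12 * t)
    + (u10 * u13 - u23 * (u10 + u13 - t)) * (u11 * t - u11 ^+ 2)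
    + (u11 * u12 - u23 * (u11 + u12 - t))
      * (- u11 * u12 + 2 * u11 * u13 - u11 * u23 - 2 * u12 * u13 - u12 * u23 + 2 * u12 * t
         + u23 * t)); first by ring.
  by rewrite T2 T3 T4 T5; ring.
by case: tau_eq => ->; ring: Q R.
Qed.

End RankTwo.
End Demazure.

(** * Independence of the reduced word, and leading terms *)

Section WordProperty.
Variables (n : nat) (C : 'M[int]_n).
Hypothesis HC : cartan C.
Variable Wl : seq 'M[int]_n.
Hypothesis HW : forall w, inW C w <-> w \in Wl.
Variables (K : comUnitRingType) (t : K) (x : 'cV[int]_n -> K).
Hypotheses (Hfgl : fgl_ok t x) (Hunit : roots_invertible x C).
Variable tau : K.
Hypothesis tau_eq : tau = 0 \/ tau = t.
Implicit Types (i j : 'I_n) (s r : seq 'I_n) (w v : 'M[int]_n) (l b c : 'cV[int]_n).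
Implicit Types (f g : 'M[int]_n -> K).
Local Notation sr := (sref C).
Local Notation al := (simple_root C).
Local Notation len := (wlength C).
Local Notation u b := (x b)^-1.
Local Notation ascentP := (ascentP HC HW).
Local Notation D := (dem C x tau).
Local Notation Ds := (dems C x tau).
#[local] Hint Resolve inW1 inW_word inW_sref is_root_simple inW_mul_sref : core.

(** Extend an alternating right factor as in [qpos_ascent]. Stopping before length [m] would leave a
    left factor keeping [al i] and [al j] positive, so [v] would send [al o] to a positive root for
    a descent [o]. *)
Lemma dihedral_factor i j m v : dihedral C i j m -> inW C v ->
  (len (v *m sr i) < len v)%N -> (len (v *m sr j) < len v)%N ->
  exists y, [/\ inW C y, v = y *m wordmx C (altw m i j) & len v = (len y + m)%N].
Proof.
move=> dih Wv desc_i desc_j; have [m_gt0 Em _] := dih.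
suff H d k e e' y : (m - k <= d)%N -> (k < m)%N ->
    (e = i /\ e' = j) \/ (e = j /\ e' = i) -> inW C y ->
    v = y *m wordmx C (altw k.+1 e e') -> len v = (len y + k.+1)%N ->
    exists y, [/\ inW C y, v = y *m wordmx C (altw m i j) & len v = (len y + m)%N].
  apply: (H _ 0%N i j (v *m sr i) (leqnn _)) => //; first by left.
  - exact: inW_mul_sref.
  - by rewrite /= mulmx1 srefK.
  by have := wlength_sref_mul HC i Wv; lia.
elim: d k e e' y => [|d IHd] k e e' y le_d lt_km ee' Wy Ev lv; first by move: le_d lt_km; lia.
have dih_e : dihedral C e e' m by case: ee' => -[-> ->] //; apply: dihedral_sym.
have [Ekm|lt_Skm] : k.+1 = m \/ (k.+1 < m)%N by move: lt_km; lia.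
  exists y; rewrite -Ekm; split=> //; rewrite Ev Ekm; congr (_ *m _).
  by case: ee' => -[-> ->].
have [lt_ye|le_ye] := ltnP (len (y *m sr e')) (len y).
  have [|E1 E2] := @alt_extend _ C HC e e' k.+1 y Wy _ lt_ye; first by rewrite -Ev.
  apply: (IHd k.+1 e' e (y *m sr e')) => //.
  - by move: le_d lt_km; lia.
  - by case: ee' => -[-> ->]; [right | left].
  - exact: inW_mul_sref.
  - by rewrite E1.
  by rewrite Ev.
have le_y : (len y <= len (y *m sr e))%N.
  by apply: (@alt_first_ascent _ C e e' k) => //; rewrite -Ev.
have := qpos_alt HC dih_e lt_Skm (qpos_ascent HC HW Wy le_y) (qpos_ascent HC HW Wy le_ye).
rewrite -Ev; set o := if _ then _ else _.
have desc_o : (len (v *m sr o) < len v)%N.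
  by rewrite /o; case: ee' => -[-> ->]; case: ifP.
by case: (ascentP o Wv) desc_o => [-> _ _|_ _ nq _ /nq //]; lia.
Qed.

Lemma dems_rcons f s i : Ds f (rcons s i) = Ds (D i f) s.
Proof. by rewrite /dems foldr_rcons. Qed.

Lemma dems_cat f s r : Ds f (s ++ r) = Ds (Ds f r) s.
Proof. by rewrite /dems foldr_cat. Qed.

Lemma dems_reduced s r f w : reduced C s -> reduced C r -> wordmx C s = wordmx C r ->
  inW C w -> Ds f s w = Ds f r w.
Proof.
move: {2}(size s).+1 (ltnSn (size s)) => N; elim: N s r f w => // N IH s r f w lt_sN red_s red_r Esr Ww.
(* With a common last letter, its operator is absorbed into [g] and induction applies to the shorter
   words. *)
have same_last s1 s2 i g v : (size s1 < N)%N -> reduced C (rcons s1 i) -> reduced C (rcons s2 i) ->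
    wordmx C (rcons s1 i) = wordmx C (rcons s2 i) -> inW C v ->
    Ds g (rcons s1 i) v = Ds g (rcons s2 i) v.
  move=> lt_s1 /reduced_rcons red1 /reduced_rcons red2 E Wv; rewrite !dems_rcons.
  apply: IH => //; apply: (inW_mulIr HC (inW_sref C i)).
  by rewrite -!wordmx_rcons.
have size_sr : size s = size r.
  by apply/eqP; rewrite eqn_leq red_s ?red_r.
case/lastP: s => [|s i] in lt_sN red_s Esr size_sr *.
  by rewrite (size0nil (esym size_sr)).
case/lastP: r => [|r j] in red_r Esr size_sr *.
  by rewrite size_rcons in size_sr.
rewrite !size_rcons in lt_sN size_sr; case: size_sr => size_sr.
have [Eij|neq_ij] := eqVneq i j; first by rewrite -Eij in red_r Esr *; apply: same_last.
have [m type_m] := coxeter_exists HC HW neq_ij.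
have braid g v : inW C v -> Ds g (altw m i j) v = Ds g (altw m j i) v.
  move=> Wv; case: type_m => type_m; first exact: (rank2_braid HC Hfgl Hunit g Wv type_m tau_eq).
  by apply: esym; apply: (rank2_braid HC Hfgl Hunit g Wv type_m tau_eq).
have dih : dihedral C i j m.
  case: type_m => type_m; first exact: dihedral_coxeter.
  by apply: dihedral_sym; apply: dihedral_coxeter.
have [m_gt0 Em _] := dih.
set v := wordmx C (rcons s i) in Esr.
have [||y [Wy Ev lv]] := dihedral_factor dih (inW_word C (rcons s i)).
- by rewrite [ltnRHS](wlength_last HC red_s).
- by rewrite -/v Esr [ltnRHS](wlength_last HC red_r).
(* Two more reduced words of [v], one ending in [i] and one in [j], agree by the braid relation and
   bridge [s] and [r]; the parity of [m] tells which is which. *)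
pose q := rword C y.
have red_q e e' : wordmx C (altw m e e') = wordmx C (altw m i j) ->
    reduced C (q ++ altw m e e') /\ wordmx C (q ++ altw m e e') = v.
  move=> Ee; have E : wordmx C (q ++ altw m e e') = v.
    by rewrite wordmx_cat wordmx_rword // Ee -Ev.
  split=> //; apply/wlength_reduced; rewrite E size_cat size_altw; exact: lv.
have [red1 E1] := red_q i j erefl; have [red2 E2] := red_q j i (esym Em).
have braid_q : Ds f (q ++ altw m i j) w = Ds f (q ++ altw m j i) w.
  by rewrite !dems_cat; apply: dems_ext => // v' Wv'; apply: braid.
case: m m_gt0 red1 E1 red2 E2 braid_q {type_m braid dih Em Ev lv red_q} => // m _.
rewrite !altw_rcons -!rcons_cat; case: (odd m) => red1 E1 red2 E2 braid_q.
  rewrite (@same_last s (q ++ altw m j i) i) ?E2 // -braid_q.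
  by rewrite (@same_last r (q ++ altw m i j) j) ?E1 // -size_sr.
rewrite (@same_last s (q ++ altw m i j) i) ?E1 // braid_q.
by rewrite (@same_last r (q ++ altw m j i) j) ?E2 // -size_sr.
Qed.

(** The value at [w] involves [f] only at [w] times products of subwords of [s]. *)
Lemma dems_vanish f s w : (forall r, (size r <= size s)%N -> f (w *m wordmx C r) = 0) ->
  Ds f s w = 0.
Proof.
elim: s w => [|i s IH] w f0 /=; first by rewrite -[w]mulmx1 (f0 [::]).
rewrite /dem !IH ?mul0r ?addr0 // => r le_rs.
  by rewrite f0 // ltnW // ltnS.
by rewrite -mulmxA -[sr i *m _]/(wordmx C (i :: r)) f0.
Qed.

(** Only the full subword contributes, through the reflection term of each operator. *)
Lemma dems_lead f s w : (forall r, (size r < size s)%N -> f (w *m wordmx C r) = 0) ->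
  Ds f s w = f (w *m wordmx C s) * \prod_(b <- betas C s) u (w *m b).
Proof.
elim: s w => [|i s IH] w f0 /=; first by rewrite mulmx1 big_nil mulr1.
rewrite /dem (@dems_vanish f s w) => [|r le_rs]; last by rewrite f0.
rewrite mul0r addr0 IH => [|r lt_rs]; last first.
  by rewrite -mulmxA -[sr i *m _]/(wordmx C (i :: r)) f0.
rewrite betas_cons big_cons [in RHS]big_map mulmxA -!mulrA; congr (_ * _); rewrite mulrC.
by congr (_ * _); apply: eq_bigr => b _; rewrite mulmxA.
Qed.

End WordProperty.

(** * Expansion of root polynomials in the bases of the twisted group algebra *)

Lemma size_masks k (m : bitseq) : m \in masks k -> size m = k.
Proof.
elim: k m => [|k IH] m /=; first by rewrite inE => /eqP->.
by rewrite mem_cat cats0 => /orP[] /mapP[m' /IH Em ->]; rewrite /= Em.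
Qed.

Lemma big_masksS (K : nmodType) k (F : bitseq -> K) :
  \sum_(m <- masks k.+1) F m =
  \sum_(m <- masks k) F (false :: m) + \sum_(m <- masks k) F (true :: m).
Proof. by rewrite /= cats0 big_cat !big_map. Qed.

Lemma big_masks_rcons (K : nmodType) k (F : bitseq -> K) :
  \sum_(m <- masks k.+1) F m =
  \sum_(m <- masks k) F (rcons m false) + \sum_(m <- masks k) F (rcons m true).
Proof.
elim: k F => [|k IH] F; first by rewrite big_masksS !big_seq1.
by rewrite big_masksS [X in _ = X + _]big_masksS [X in _ = _ + X]big_masksS !IH addrACA.
Qed.

Section Expansion.
Variables (n : nat) (C : 'M[int]_n).
Hypothesis HC : cartan C.
Variable Wl : seq 'M[int]_n.
Hypothesis HW : forall w, inW C w <-> w \in Wl.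
Variable w0 : 'M[int]_n.
Hypothesis Hw0 : longest C w0.
Variables (K : comUnitRingType) (t : K) (x : 'cV[int]_n -> K) (act : 'M[int]_n -> K -> K).
Hypotheses (Hfgl : fgl_ok t x) (Hact : act_ok t x act C) (Hunit : roots_invertible x C).
Implicit Types (i j : 'I_n) (s r : seq 'I_n) (w v u : 'M[int]_n) (b : 'cV[int]_n).
Implicit Types (f g c : 'M[int]_n -> K) (a : QW n K).
Local Notation sr := (sref C).
Local Notation al := (simple_root C).
Local Notation len := (wlength C).
Local Notation ascentP := (ascentP HC HW).
#[local] Hint Resolve inW1 inW_word inW_sref is_root_simple inW_mul_sref : core.

(* The value at delta_w * a of the left Q-linear extension of f to Q_W. *)
Definition qeval a f w : K := \sum_(p <- a) act w p.1 * f (w *m p.2).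

Definition pointfun u w : K := (w == u)%:R.

Lemma qcoef_qeval a u : qcoef a u = qeval a (pointfun u) 1%:M.
Proof.
rewrite /qcoef big_mkcond; apply: eq_bigr => p _; rewrite mul1mx /pointfun.
by have [-> _ _] := Hact; case: eqP; rewrite ?mulr1 ?mulr0.
Qed.

Lemma qeval_mul a a' f w : inW C w -> all (fun p => pb (inW C p.2)) a ->
  qeval (qmul act a a') f w = \sum_(p <- a) act w p.1 * qeval a' f (w *m p.2).
Proof.
have [_ actM actR] := Hact; move=> Ww /allP Wa.
rewrite /qeval /qmul big_allpairs_dep /=; apply: eq_big_seq => p /Wa/pbP Wp.
have [_ Mw _ _ _] := actR w Ww.
rewrite mulr_sumr; apply: eq_bigr => q _.
by rewrite Mw actM // mulmxA mulrA.
Qed.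

Lemma act_inv w b : inW C w -> is_root C b -> act w (x b)^-1 = (x (w *m b))^-1.
Proof.
move=> Ww Rb; have [_ _ actR] := Hact; have [_ Mw w1 _ xw] := actR w Ww.
have Ub := Hunit Rb; have Uwb := Hunit (is_root_mul Ww Rb).
by apply: (mulrI Uwb); rewrite -{1}xw -Mw !divrr.
Qed.

Lemma act_opp w (y : K) : inW C w -> act w (- y) = - act w y.
Proof.
move=> Ww; have [_ _ actR] := Hact; have [Aw _ _ _ _] := actR w Ww.
have act0 : act w 0 = 0 by apply: (addrI (act w 0)); rewrite -Aw !addr0.
by apply: (addrI (act w y)); rewrite -Aw !subrr act0.
Qed.

Lemma qeval_one f w : inW C w -> qeval (qone n K) f w = f w.
Proof.
move=> Ww; have [_ _ actR] := Hact; have [_ _ w1 _ _] := actR w Ww.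
by rewrite /qeval big_seq1 /= w1 mul1r mulmx1.
Qed.

Lemma qeval_Xword s f w : inW C w -> qeval (Xword x act C s) f w = dems C x 0 f s w.
Proof.
elim: s w => [|i s IH] w Ww /=; first exact: qeval_one.
rewrite qeval_mul //=; last by rewrite !andbT; apply/andP; split; apply/pbP.
rewrite big_cons big_seq1 /= act_opp // act_inv // mulmx1 !IH //; last exact: inW_mul_sref.
by rewrite /dem; ring.
Qed.

(** The scalar term of [Y_i] is the inverse at [- al i], that is, [t] minus the inverse at [al i],
    which gives [tau = t]. *)
Lemma qeval_Yword s f w : inW C w -> qeval (Yword x act C s) f w = dems C x t f s w.
Proof.
elim: s w => [|i s IH] w Ww /=; first exact: qeval_one.
rewrite qeval_mul //=; last by rewrite !andbT; apply/andP; split; apply/pbP.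
have RNi : is_root C (- al i) by apply: is_root_opp.
rewrite big_cons big_seq1 /= !act_inv // mulmx1 !IH //; last exact: inW_mul_sref.
rewrite mulmxN (fgl_inv_opp HC Hfgl Hunit); last by apply: is_root_mul.
by rewrite /dem; ring.
Qed.

(** [op] stands for [Xword] with [tau = 0] or [Yword] with [tau = t], so that both bases are treated
    at once. *)
Variables (tau : K) (op : seq 'I_n -> QW n K).
Hypothesis tau_eq : tau = 0 \/ tau = t.
Hypothesis op_dems : forall s f w, inW C w -> qeval (op s) f w = dems C x tau f s w.
Local Notation D := (dem C x tau).
Local Notation Ds := (dems C x tau).
Local Notation basis := (fun v => op (rword C v)).
Local Notation expands s c := (coefs_in basis Wl (op s) c).

Lemma dems_sum (I : eqType) (r : seq I) (e : I -> K) (F : I -> 'M[int]_n -> K) s w :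
  Ds (fun v => \sum_(k <- r) e k * F k v) s w = \sum_(k <- r) e k * Ds (F k) s w.
Proof.
elim: s w => //= i s IH w; rewrite /dem !IH !mulr_suml -big_split /=.
by apply: eq_bigr => k _; ring.
Qed.

Lemma dems_scale (e : K) f s w : Ds (fun v => e * f v) s w = e * Ds f s w.
Proof. by elim: s w => //= i s IH w; rewrite /dem !IH; ring. Qed.

(** Coefficients are the evaluations at the identity of point functions, and on W every [f] is a
    linear combination of point functions. Expansions thus become identities between operators. *)
Lemma expandsP s c : expands s c <->
  forall f, Ds f s 1%:M = \sum_(v <- undup Wl) c v * Ds f (rword C v) 1%:M.
Proof.
have coefE u : qcoef (flatten [seq qscale (c v) (op (rword C v)) | v <- undup Wl]) u =
    \sum_(v <- undup Wl) c v * Ds (pointfun u) (rword C v) 1%:M.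
  rewrite /qcoef big_flatten /= big_map; apply: eq_bigr => v _.
  rewrite /qscale big_map -op_dems // -qcoef_qeval /qcoef mulr_sumr.
  by apply: eq_bigl.
split=> [Hc f | Hf u]; last by rewrite coefE qcoef_qeval op_dems.
have decomp w : inW C w -> f w = \sum_(u <- undup Wl) f u * pointfun u w.
  move=> Ww; have Mw : w \in undup Wl by rewrite (mem_undupW HW); apply/pbP.
  rewrite (bigD1_seq w) ?undup_uniq //= /pointfun eqxx mulr1 big1 ?addr0 // => u.
  by rewrite eq_sym => /negPf->; rewrite mulr0.
have decompD r : Ds f r 1%:M = \sum_(u <- undup Wl) f u * Ds (pointfun u) r 1%:M.
  by rewrite (dems_ext x tau r decomp) // dems_sum.
rewrite decompD; under [RHS]eq_bigr do rewrite decompD mulr_sumr.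
rewrite exchange_big; apply: eq_bigr => u _ /=.
rewrite -op_dems // -qcoef_qeval Hc coefE mulr_sumr.
by apply: eq_bigr => v _; ring.
Qed.

Lemma rword1 : rword C 1%:M = [::].
Proof. by apply: size0nil; apply: wlength1. Qed.

Lemma expands_nil : expands [::] (fun v => (v == 1%:M)%:R).
Proof.
apply/expandsP => f; have M1 : 1%:M \in undup Wl by rewrite (mem_undupW HW); apply/pbP.
rewrite (bigD1_seq 1%:M) ?undup_uniq //= eqxx mul1r rword1 big1 ?addr0 // => v.
by move/negPf->; rewrite mul0r.
Qed.

Lemma tau_quadratic : tau * (tau - t) = 0.
Proof. by case: tau_eq => ->; rewrite ?subrr ?mulr0 ?mul0r. Qed.

Lemma dems_rword_rcons v i f w : inW C v -> inW C w -> (len v < len (v *m sr i))%N ->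
  Ds (D i f) (rword C v) w = Ds f (rword C (v *m sr i)) w.
Proof.
move=> Wv Ww; case: (ascentP i Wv) => // El _ _ _; rewrite -dems_rcons.
have Wvi : inW C (v *m sr i) by apply: inW_mul_sref.
apply: (dems_reduced HC HW Hfgl Hunit) => //.
- by apply/wlength_reduced; rewrite wordmx_rcons wordmx_rword // El size_rcons.
- exact: reduced_rword.
by rewrite wordmx_rcons !wordmx_rword.
Qed.

Lemma dems_rword_descent v i f w : inW C v -> inW C w -> (len (v *m sr i) < len v)%N ->
  Ds (D i f) (rword C v) w = (2 * tau - t) * Ds f (rword C v) w.
Proof.
move=> Wv Ww lt_vi; have Wvi : inW C (v *m sr i) by apply: inW_mul_sref.
have E g : Ds g (rword C v) w = Ds (D i g) (rword C (v *m sr i)) w.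
  by rewrite -{1}(srefK HC v i) dems_rword_rcons ?srefK.
rewrite !E -dems_scale; apply: dems_ext => // w' Ww'.
by rewrite (dem_quadratic HC Hfgl Hunit) ?tau_quadratic.
Qed.

(** On the right, the letter [i] sends the basis element of [v] to that of [v *m sr i] at an ascent
    and multiplies it by [2 * tau - t] at a descent. *)
Lemma expands_rcons s c i : expands s c -> expands (rcons s i)
  (fun v => if (len (v *m sr i) < len v)%N then c (v *m sr i) + (2 * tau - t) * c v else 0).
Proof.
move/expandsP => Hs; apply/expandsP => f; rewrite dems_rcons Hs.
pose E v := Ds f (rword C v) 1%:M.
transitivity (\sum_(v <- undup Wl) (if (len v < len (v *m sr i))%N then c v * E (v *m sr i) else 0)
   + \sum_(v <- undup Wl) (if (len (v *m sr i) < len v)%N then (2 * tau - t) * c v * E v else 0)).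
  rewrite -big_split /=; apply: eq_big_seq => v; rewrite (mem_undupW HW) => /pbP Wv.
  case: ltngtP => [lt_v|lt_v|Ev].
  - by rewrite dems_rword_rcons // addr0.
  - by rewrite dems_rword_descent // add0r mulrCA mulrA.
  by exfalso; case: (ascentP i Wv); move: Ev => ->; lia.
(* Reindexing the ascent terms by [v *m sr i] collects everything on the elements with descent
   [i]. *)
rewrite -[X in X + _](perm_big _ (perm_undupW HC HW (inW_sref C i))) big_map -big_split /=.
apply: eq_big_seq => v; rewrite (mem_undupW HW) => /pbP Wv; rewrite srefK //.
by case: ifP => _; rewrite ?addr0 ?mul0r ?mulrDl.
Qed.

Lemma expands_exists s : exists c, expands s c.
Proof.
elim/last_ind: s => [|s i [c Hc]]; first by eexists; apply: expands_nil.
by eexists; apply: expands_rcons Hc.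
Qed.

(* The basis is triangular for the length order, with units on the diagonal. *)
Lemma expands_unique s c c' v : expands s c -> expands s c' -> inW C v -> c v = c' v.
Proof.
move=> /expandsP Hc /expandsP Hc'.
(* Downward induction on the length of [v]: testing on the point function at [v] kills the other
   basis elements of at most that length, and the longer ones agree by induction. *)
move: {2}(len w0 - len v).+1 (ltnSn (len w0 - len v)) => N; elim: N v => // N IH v lt_N Wv.
have Mv : v \in undup Wl by rewrite (mem_undupW HW); apply/pbP.
have := Hc (pointfun v); rewrite Hc' !(bigD1_seq v Mv) ?undup_uniq //=.
have -> : \sum_(u <- undup Wl | u != v) c' u * Ds (pointfun v) (rword C u) 1%:M =
          \sum_(u <- undup Wl | u != v) c u * Ds (pointfun v) (rword C u) 1%:M.
  rewrite big_seq_cond [RHS]big_seq_cond; apply: eq_bigr => u /andP[].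
  rewrite (mem_undupW HW) => /pbP Wu neq_uv.
  have [lt_vu|le_uv] := ltnP (len v) (len u).
    rewrite IH //; have [_ max0] := Hw0; have := max0 u Wu; move: lt_N lt_vu; lia.
  rewrite dems_lead => [|r lt_r].
    by rewrite mul1mx wordmx_rword // /pointfun (negPf neq_uv) mul0r !mulr0.
  rewrite /pointfun mul1mx; case: eqP => // Er.
  have := wlength_le C r; rewrite Er => le_vr.
  by have := leq_ltn_trans le_vr (leq_trans lt_r le_uv); rewrite ltnn.
move/addIr; rewrite dems_lead => [|r lt_r]; last first.
  rewrite /pointfun mul1mx; case: eqP => // Er.
  by have := wlength_le C r; rewrite Er leqNgt lt_r.
rewrite mul1mx wordmx_rword // /pointfun eqxx mul1r => E.
suff U : \prod_(b <- betas C (rword C v)) (x (1%:M *m b))^-1 \is a GRing.unit.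
  by apply: esym; apply: (mulIr U).
rewrite big_seq; apply: rpred_prod => b Mb; rewrite unitrV mul1mx; apply: Hunit; apply: is_root_betas Mb.
Qed.

(** Existence makes the choice in [bcoef] a true expansion; uniqueness then determines its values on
    W, which yields the recursion below. *)
Lemma bcoef_expands s : expands s (bcoef basis Wl (op s)).
Proof.
exact: (epsilon_spec (inhabits (fun _ => 0)) (coefs_in basis Wl (op s)) (expands_exists s)).
Qed.

Lemma bcoef_nil v : inW C v -> bcoef basis Wl (op [::]) v = (v == 1%:M)%:R.
Proof. exact: expands_unique (bcoef_expands _) expands_nil. Qed.

Lemma bcoef_rcons s i v : inW C v -> bcoef basis Wl (op (rcons s i)) v =
  if (len (v *m sr i) < len v)%N
  then bcoef basis Wl (op s) (v *m sr i) + (2 * tau - t) * bcoef basis Wl (op s) v else 0.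
Proof. exact: expands_unique (bcoef_expands _) (expands_rcons i (bcoef_expands s)). Qed.

Variable eps : 'cV[int]_n -> K.

(** The common form of [KY], with [eps b = - x b], and [KX], with [eps b = x (- b)], for an
    arbitrary word; a mask records the factors from which the operator term is taken. *)
Definition rootpoly s v : K := \sum_(m <- masks (size s))
  (\prod_(b <- mask m (betas C s)) eps b) * bcoef basis Wl (op (mask m s)) v.

Lemma rootpoly_nil v : inW C v -> rootpoly [::] v = (v == 1%:M)%:R.
Proof. by move=> Wv; rewrite /rootpoly big_seq1 /= big_nil mul1r bcoef_nil. Qed.

Lemma rootpoly_rcons s i v : inW C v -> rootpoly (rcons s i) v = rootpoly s v +
  eps (wordmx C s *m al i) * if (len (v *m sr i) < len v)%N
    then rootpoly s (v *m sr i) + (2 * tau - t) * rootpoly s v else 0.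
Proof.
move=> Wv; rewrite /rootpoly size_rcons big_masks_rcons betas_rcons.
have size_betas : size (betas C s) = size s.
  by rewrite /betas size_map size_zip size_iota minnn.
congr (_ + _).
  apply: eq_big_seq => m /size_masks Em.
  by rewrite !mask_rcons ?size_betas // !cats0.
transitivity (\sum_(m <- masks (size s)) eps (wordmx C s *m al i) *
   ((\prod_(b <- mask m (betas C s)) eps b) * bcoef basis Wl (op (rcons (mask m s) i)) v)).
  apply: eq_big_seq => m /size_masks Em.
  rewrite !mask_rcons ?size_betas //= big_cat big_seq1 cats1 /=.
  by rewrite mulrA [eps _ * _]mulrC.
rewrite -mulr_sumr; congr (_ * _).
under eq_bigr do rewrite bcoef_rcons //.
case: ifP => _; last by rewrite big1 // => m _; rewrite mulr0.
by rewrite mulr_sumr -big_split; apply: eq_bigr => m _ /=; ring.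
Qed.

End Expansion.

(** * The recursion for the classes in the GKM model *)

Section GKM.
Variables (n : nat) (C : 'M[int]_n).
Hypothesis HC : cartan C.
Variable Wl : seq 'M[int]_n.
Hypothesis HW : forall w, inW C w <-> w \in Wl.
Variable w0 : 'M[int]_n.
Hypothesis Hw0 : longest C w0.
Variables (K : comUnitRingType) (t : K) (x : 'cV[int]_n -> K).
Hypotheses (Hfgl : fgl_ok t x) (Hunit : roots_invertible x C).
Implicit Types (i j k : 'I_n) (s r : seq 'I_n) (w v y : 'M[int]_n) (a b : 'cV[int]_n).
Implicit Types (f g : 'M[int]_n -> K).
Local Notation sr := (sref C).
Local Notation al := (simple_root C).
Local Notation len := (wlength C).
Local Notation u b := (x b)^-1.
Local Notation ascentP := (ascentP HC HW).
#[local] Hint Resolve inW1 inW_word inW_sref is_root_simple inW_mul_sref : core.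

Lemma mem_posroots a : a \in posroots C Wl <-> pos_root C a.
Proof.
rewrite mem_filter mem_undup; split=> [/andP[/pbP] //|pa].
apply/andP; split; first exact/pbP.
have [[w [i [/HW Ww ->]]] _] := pa; apply/allpairsP.
by exists (w, i); rewrite mem_enum.
Qed.

Lemma posroots_uniq : uniq (posroots C Wl).
Proof. by rewrite filter_uniq // undup_uniq. Qed.

(** The index set of [theta] is the inversion set listed by [betas], so the product grows by one
    factor per letter. *)
Lemma theta_betas w : inW C w ->
  theta t x C Wl w = \prod_(b <- betas C (rword C w)) (1 - t * x b)^-1.
Proof.
move=> Ww; rewrite /theta -big_filter; apply: perm_big.
have [Ub Mb] := betas_inversions HC HW (reduced_rword Ww).
set w' := wordmx C _ in Mb.
have w'w : w' *m w = 1%:M by rewrite -[X in w' *m X](wordmx_rword Ww) wordmx_rev_mul.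
have ww' : w *m w' = 1%:M by rewrite -[X in X *m w'](wordmx_rword Ww) wordmx_mul_rev.
apply: uniq_perm => //; first by rewrite filter_uniq ?posroots_uniq.
move=> b; rewrite mem_filter; apply/andP/idP => [[/pbP[g [ng Eb]] /mem_posroots pb]|/Mb[pb nb]].
  by apply/Mb; split=> //; rewrite Eb mulmxA w'w mul1mx.
split; last exact/mem_posroots.
by apply/pbP; exists (w' *m b); split=> //; rewrite mulmxA ww' mul1mx.
Qed.

Variable tau : K.
Hypothesis tau_eq : tau = 0 \/ tau = t.
Local Notation D := (dem C x tau).
Local Notation Ds := (dems C x tau).

(** The word is reversed because in the classes the last letter acts last, whereas in [dems] the
    first one does. *)
Definition zclass v := Ds (zeta0 x C Wl) (rev (rword C v)).
Definition gkm v w := zclass (v *m w0) (w *m w0).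

Lemma zclass_descent v k w : inW C v -> inW C w -> (len (v *m sr k) < len v)%N ->
  zclass v w = D k (zclass (v *m sr k)) w.
Proof.
move=> Wv Ww; case: (ascentP k Wv) => [-> _ _|El _ _ _]; first by rewrite ltnNge leqnSn.
have Wvk : inW C (v *m sr k) by apply: inW_mul_sref.
have red_vk : reduced C (rcons (rword C (v *m sr k)) k).
  by apply/wlength_reduced; rewrite wordmx_rcons wordmx_rword // srefK // size_rcons.
rewrite /zclass -[RHS]/(Ds _ (k :: rev (rword C (v *m sr k))) w) -rev_rcons.
apply: (dems_reduced HC HW Hfgl Hunit) => //.
- exact/reduced_rev/reduced_rword.
- exact: reduced_rev.
apply: (inW_mulIr HC Wv); rewrite -{2}(wordmx_rword Wv) wordmx_rev_mul //.
have E : wordmx C (rcons (rword C (v *m sr k)) k) = v.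
  by rewrite wordmx_rcons wordmx_rword // srefK.
by rewrite -{2}E wordmx_rev_mul.
Qed.

Lemma gkm_ascent v w i : inW C v -> inW C w -> (len v < len (v *m sr i))%N ->
  gkm v w = gkm (v *m sr i) (w *m sr i) * u (- (w *m al i))
            + gkm (v *m sr i) w * (tau - u (- (w *m al i))).
Proof.
move=> Wv Ww asc; have [W0 _] := Hw0.
have [k [Ek Ealk]] := longest_conj HC HW i Hw0.
have Wv0 : inW C (v *m w0) by apply: inW_mul.
have E y : y *m w0 *m sr k = y *m sr i *m w0 by rewrite -mulmxA Ek mulmxA.
rewrite /gkm (@zclass_descent _ k) //; last first.
(* The root [v *m w0 *m al k] is the opposite of the positive root [v *m al i], so [k] is a descent
   of [v *m w0]. *)
- case: (ascentP k Wv0) => [_ _ nq|-> //]; case: nq.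
  rewrite -mulmxA Ealk mulmxN opprK.
  by case: (ascentP i Wv) asc.
- exact: inW_mul.
by rewrite /dem !E -[w *m w0 *m al k]mulmxA Ealk mulmxN.
Qed.

(** Moving the point from [w0] to the identity takes at least as many letters as the length of [w0],
    so only the leading term of [dems_lead] can survive, and it sits at the identity only for
    [v = 1]. *)
Lemma gkm1 v : inW C v -> gkm v 1%:M = (v == 1%:M)%:R.
Proof.
move=> Wv; have [W0 max0] := Hw0; have Wv0 : inW C (v *m w0) by apply: inW_mul.
rewrite /gkm mul1mx /zclass dems_lead => [|r]; last first.
  rewrite size_rev => lt_r; rewrite /zeta0; case: eqP => // E.
  have lr := wlength_inv HC (inW_word C r) E; have := wlength_le C r; have := max0 _ Wv0.
  by rewrite -lr; rewrite /wlength in lt_r *; lia.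
have [->|neq_v1] := eqVneq v 1%:M; last first.
  rewrite /zeta0; case: eqP => [E|_]; last by rewrite mul0r.
  case/eqP: neq_v1; apply: (inW_mulIr HC W0); rewrite mul1mx.
  have := congr1 (mulmx^~ (v *m w0)) E; rewrite /= mul1mx => <-.
  by rewrite -mulmxA -{2}(wordmx_rword Wv0) wordmx_rev_mul // mulmx1.
rewrite mul1mx -{1}(wordmx_rword W0) wordmx_mul_rev // /zeta0 eqxx.
set s := rev _; have red_s : reduced C s by apply/reduced_rev/reduced_rword.
have [Us Ms] := betas_inversions HC HW red_s.
rewrite revK wordmx_rword // in Ms.
have [y [Wy yw0 w0y]] := inW_inv HC W0.
have perm_s : perm_eq (posroots C Wl) [seq - (w0 *m b) | b <- betas C s].
  apply: uniq_perm; first exact: posroots_uniq.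
    rewrite map_inj_uniq // => b b' /oppr_inj /(congr1 (mulmx y)).
    by rewrite !mulmxA yw0 !mul1mx.
  move=> a; apply/idP/mapP => [/mem_posroots pa|[b /Ms[_ nb] ->]]; last exact/mem_posroots.
  have ny : neg_root C (y *m a).
    apply: (neg_root_mul HC Wy) pa => i; apply: (longest_neg HC HW).
    exact: longest_inv Hw0 yw0 Wy.
  exists (- (y *m a)); last by rewrite mulmxN opprK mulmxA w0y mul1mx.
  by apply/Ms; split=> //; rewrite mulmxN mulmxA w0y mul1mx /neg_root opprK.
rewrite (perm_big _ perm_s) big_map -big_split big_seq big1 //= => b Mb.
rewrite opprK divrr //; apply: Hunit; apply: is_root_mul => //; exact: is_root_betas Mb.
Qed.

End GKM.

(** * Matching the two recursions *)

Section Comparison.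
Variables (n : nat) (C : 'M[int]_n).
Hypothesis HC : cartan C.
Variable Wl : seq 'M[int]_n.
Hypothesis HW : forall w, inW C w <-> w \in Wl.
Variable w0 : 'M[int]_n.
Hypothesis Hw0 : longest C w0.
Variables (K : comUnitRingType) (t : K) (x : 'cV[int]_n -> K) (act : 'M[int]_n -> K -> K).
Hypotheses (Hfgl : fgl_ok t x) (Hact : act_ok t x act C) (Hunit : roots_invertible x C).
Implicit Types (i : 'I_n) (s : seq 'I_n) (w v : 'M[int]_n) (b : 'cV[int]_n).
Local Notation sr := (sref C).
Local Notation al := (simple_root C).
Local Notation len := (wlength C).
Local Notation u b := (x b)^-1.
Local Notation ascentP := (ascentP HC HW).
#[local] Hint Resolve inW1 inW_word inW_sref is_root_simple inW_mul_sref : core.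

Lemma psi_gkm v w : psi x C Wl w0 v w = gkm C Wl w0 x 0 v w.
Proof.
rewrite /psi /zetaX /gkm /zclass -{1}(revK (rword C _)) foldl_rev.
elim: (rev _) (w *m w0) => //= i s IH y.
by rewrite /GX !IH /dem; ring.
Qed.

Lemma xi_gkm v w : inW C w -> xi x C Wl w0 v w = gkm C Wl w0 x t v w.
Proof.
move=> Ww; have [W0 _] := Hw0.
rewrite /xi /zetaY /gkm /zclass -{1}(revK (rword C _)) foldl_rev.
elim: (rev _) (w *m w0) (inW_mul Ww W0) => //= i s IH y Wy.
rewrite /GY !IH //; last exact: inW_mul_sref.
rewrite (fgl_inv_opp HC Hfgl Hunit) /dem; last by apply: is_root_mul.
by ring.
Qed.

(** The parameters cross over: classes with [tau = t] match the basis with [tau = 0]. If [i] is a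
    descent of [v], solve [gkm_ascent] at [v *m sr i] for the new value; if it is an ascent, the
    class is unchanged under right multiplication of the point by [s_i]. *)
Lemma xi_rootpoly s v : inW C v -> gkm C Wl w0 x t v (wordmx C s) =
  rootpoly C Wl (Xword x act C) (fun b => x (- b)) s v.
Proof.
have tau_eq : t = 0 \/ t = t by right.
have op_dems s' f w : inW C w -> qeval act (Xword x act C s') f w = dems C x 0 f s' w.
  exact: (qeval_Xword Hact Hunit).
have tau0 : 0 = 0 :> K \/ 0 = t by left.
elim/last_ind: s v => [|s i IH] v Wv.
  rewrite (rootpoly_nil HC HW Hw0 Hfgl Hact Hunit tau0 op_dems) //.
  exact: (gkm1 HC HW Hw0 Hunit).
rewrite (rootpoly_rcons HC HW Hw0 Hfgl Hact Hunit tau0 op_dems) // -!IH //; last exact: inW_mul_sref.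
rewrite wordmx_rcons; set w := wordmx C s.
have Ww : inW C w by apply: inW_word.
have Ra : is_root C (w *m al i) by apply: is_root_mul.
have RNa := is_root_opp HC Ra.
have uN := fgl_inv_opp HC Hfgl Hunit Ra.
have xu : x (- (w *m al i)) * u (- (w *m al i)) = 1 by rewrite divrr // Hunit.
have Wwi : inW C (w *m sr i) by apply: inW_mul_sref.
have Wvi : inW C (v *m sr i) by apply: inW_mul_sref.
case: ltngtP => [desc|asc|El].
- have := gkm_ascent HC HW Hw0 Hfgl Hunit tau_eq Wvi Ww (i := i).
  rewrite srefK // => /(_ desc) E.
  rewrite E; ring: xu.
- rewrite mulr0 addr0 !(gkm_ascent HC HW Hw0 Hfgl Hunit tau_eq _ _ asc) // srefK //.
  by rewrite -[w *m sr i *m al i]mulmxA mulmx_sref_root // mulmxN opprK uN; ring.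
by exfalso; case: (ascentP i Wv); move: El => ->; lia.
Qed.

(** Here an ascent [i] of [v] multiplies the class by [1 - t * x (- b)] with [b = w *m al i]. This
    is the inverse of [1 - t * x b], the factor that the last letter adds to the product. *)
Lemma psi_rootpoly s v : inW C v -> gkm C Wl w0 x 0 v (wordmx C s) =
  (\prod_(b <- betas C s) (1 - t * x b)^-1) *
  rootpoly C Wl (Yword x act C) (fun b => - x b) s v.
Proof.
have tau0 : 0 = 0 :> K \/ 0 = t by left.
have op_dems s' f w : inW C w -> qeval act (Yword x act C s') f w = dems C x t f s' w.
  exact: (qeval_Yword HC Hfgl Hact Hunit).
have tau_eq : t = 0 \/ t = t by right.
elim/last_ind: s v => [|s i IH] v Wv.
  rewrite (rootpoly_nil HC HW Hw0 Hfgl Hact Hunit tau_eq op_dems) // big_nil mul1r.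
  exact: (gkm1 HC HW Hw0 Hunit).
rewrite (rootpoly_rcons HC HW Hw0 Hfgl Hact Hunit tau_eq op_dems) //.
rewrite wordmx_rcons betas_rcons -cats1 big_cat big_seq1 /=; set w := wordmx C s.
set th := \prod_(b <- _) _ in IH *; set R := rootpoly _ _ _ _ _ in IH *.
have Ww : inW C w by apply: inW_word.
have Ra : is_root C (w *m al i) by apply: is_root_mul.
have RNa := is_root_opp HC Ra.
have uN := fgl_inv_opp HC Hfgl Hunit Ra.
have xa : x (w *m al i) * u (w *m al i) = 1 by rewrite divrr // Hunit.
have xNa : x (- (w *m al i)) * u (- (w *m al i)) = 1 by rewrite divrr // Hunit.
have Wwi : inW C (w *m sr i) by apply: inW_mul_sref.
have Wvi : inW C (v *m sr i) by apply: inW_mul_sref.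
have [x0 xD] := Hfgl; have := xD (w *m al i) (- (w *m al i)); rewrite subrr x0 => E0.
have -> : (1 - t * x (w *m al i))^-1 = 1 - t * x (- (w *m al i)).
  (* The substitution [1 - t x] turns the formal group law into multiplication, and opposite roots
     sum to zero. *)
  have E1 : (1 - t * x (w *m al i)) * (1 - t * x (- (w *m al i))) = 1.
    transitivity (1 - t * (x (w *m al i) + x (- (w *m al i)) - t * x (w *m al i) * x (- (w *m al i)))).
      by ring.
    by rewrite -E0 mulr0 subr0.
  have U1 : 1 - t * x (w *m al i) \is a GRing.unit.
    by apply/unitrPr; exists (1 - t * x (- (w *m al i))).
  by apply: (mulrI U1); rewrite divrr // E1.
case: ltngtP => [desc|asc|El].
- have := gkm_ascent HC HW Hw0 Hfgl Hunit tau0 Wvi Ww (i := i).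
  rewrite srefK // => /(_ desc) E.
  transitivity (gkm C Wl w0 x 0 v w + x (- (w *m al i)) * gkm C Wl w0 x 0 (v *m sr i) w).
    by rewrite E; ring: xNa.
  have E1 : t * x (w *m al i) * x (- (w *m al i)) = x (w *m al i) + x (- (w *m al i)).
    by apply/eqP; rewrite eq_sym -subr_eq0 -E0.
  by rewrite !IH //; ring: E1.
- transitivity ((1 - t * x (- (w *m al i))) * gkm C Wl w0 x 0 v w); last first.
    by rewrite IH //; ring.
  rewrite !(gkm_ascent HC HW Hw0 Hfgl Hunit tau0 _ _ asc) // srefK //.
  rewrite -[w *m sr i *m al i]mulmxA mulmx_sref_root // mulmxN opprK.
  have -> : u (w *m al i) = t - u (- (w *m al i)) by rewrite uN; ring.
  by ring: xNa.
by exfalso; case: (ascentP i Wv); move: El => ->; lia.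
Qed.

End Comparison.

Theorem theorem5p2 (n : nat) (C : 'M[int]_n) (HC : cartan C)
    (Wl : seq 'M[int]_n) (HW : forall w, inW C w <-> w \in Wl)
    (w0 : 'M[int]_n) (Hw0 : longest C w0)
    (K : comUnitRingType) (t : K) (x : 'cV[int]_n -> K) (act : 'M[int]_n -> K -> K)
    (Hfgl : fgl_ok t x) (Hact : act_ok t x act C) (Hunit : roots_invertible x C) :
  forall v w : 'M[int]_n, inW C v -> inW C w ->
    psi x C Wl w0 v w = theta t x C Wl w * KY x act C Wl v w
    /\ xi x C Wl w0 v w = KX x act C Wl v w.
Proof.
(* [KY] and [KX] unfold to [rootpoly] at the word [rword C w], so the comparison for words
   applies. *)
move=> v w Wv Ww; split.
  rewrite psi_gkm -{1}(wordmx_rword Ww).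
  rewrite (psi_rootpoly HC HW Hw0 Hfgl Hact Hunit) // (theta_betas HC HW) //.
rewrite (xi_gkm HC Wl Hw0 Hfgl Hunit v Ww) -{1}(wordmx_rword Ww).
exact: (xi_rootpoly HC HW Hw0 Hfgl Hact Hunit).
Qed.
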